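(* Let $\mathcal{L}\subseteq\mathbb{Z}^3$ be an order ideal with $\mathcal{L}\subseteq C(0,0,0)$ and $\mathcal{U}\cap C(0,0,0)$ finite, and let $\mathcal{U},\mathcal{I}$, the functions $f_{i,j,k}$, groves and the monomials $m(G)$ be as defined in the context. Let $N$ be any cutoff for $\mathcal{I}$. Then $$f_{0,0,0}=\sum_G m(G),$$ where the sum is taken over all $\mathcal{I}$-groves $G$ within radius $N$.
   Context: For $(i,j,k)\in\mathbb{Z}^3$ let $C(i,j,k)=\{(i',j',k')\in\mathbb{Z}^3 : i'\le i,\ j'\le j,\ k'\le k\}$. Let $\mathcal{L}\subseteq\mathbb{Z}^3$ satisfy: whenever $(i,j,k)\in\mathcal{L}$, $C(i,j,k)\subseteq\mathcal{L}$. Put $\mathcal{U}=\mathbb{Z}^3\setminus\mathcal{L}$ and $\mathcal{I}=\{(i,j,k)\in\mathcal{L} : (i+1,j+1,k+1)\in\mathcal{U}\}$. To each $(i,j,k)\in\mathcal{I}$ assign a formal variable $x_{i,j,k}$, and introduce formal ''edge variables'' $a_{j,k},b_{i,k},c_{i,j}$ for all $i,j,k\in\mathbb{Z}$. Define $f_{i,j,k}=x_{i,j,k}$ for $(i,j,k)\in\mathcal{I}$, and for $(i,j,k)\in\mathcal{U}$ with $C(i,j,k)\cap\mathcal{U}$ finite, $$f_{i,j,k}=\frac{b_{i,k}c_{i,j}f_{i-1,j,k}f_{i,j-1,k-1}+c_{i,j}a_{j,k}f_{i,j-1,k}f_{i-1,j,k-1}+a_{j,k}b_{i,k}f_{i,j,k-1}f_{i-1,j-1,k}}{f_{i-1,j-1,k-1}}$$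 (a rational function in these variables). A cutoff for $\mathcal{I}$ is an integer $N$ such that (i) $(i,j,k)\in\mathcal{I}$ whenever $i+j+k\le -N$ and $\max\{i,j,k\}=0$; and (ii) $(i,j,k)\notin\mathcal{I}$ whenever $i+j+k\le -N-3$ and $\max\{i,j,k\}<0$. For $(i,j,k)\in\mathcal{I}$ set $r_a(i,j,k)=\{(i,j,k),(i,j-1,k),(i,j,k-1),(i,j-1,k-1)\}$, $r_b(i,j,k)=\{(i,j,k),(i-1,j,k),(i,j,k-1),(i-1,j,k-1)\}$, $r_c(i,j,k)=\{(i,j,k),(i-1,j,k),(i,j-1,k),(i-1,j-1,k)\}$. A rhombus is any such set contained in $\mathcal{I}$. Its long edge is $e_a(i,j,k)=\{(i,j-1,k),(i,j,k-1)\}$, $e_b(i,j,k)=\{(i-1,j,k),(i,j,k-1)\}$, $e_c(i,j,k)=\{(i-1,j,k),(i,j-1,k)\}$ respectively, and its short edge is $e'_a(i,j,k)=\{(i,j,k),(i,j-1,k-1)\}$, $e'_b(i,j,k)=\{(i,j,k),(i-1,j,k-1)\}$, $e'_c(i,j,k)=\{(i,j,k),(i-1,j-1,k)\}$ respectively. Let $\mathcal{G}$ be the graph with vertex set $\mathcal{I}$ whose edges are the long and short edges of all rhombi. For a cutoff $N$, an $\mathcal{I}$-grove within radius $N$ is a subgraph $G\subseteq\mathcal{G}$ such that: (Completeness) the vertex set of $G$ is $\mathcal{I}$; (Complementarity) for every rhombus exactly one of its two edges lies in $G$; (Compactness) for every rhombus all of whose vertices satisfy $i+j+k<-N$, its short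 edge lies in $G$; (Connectivity) every connected component of $G$ contains exactly one of the following vertex sets, and each of these sets is contained in some component: $\{(0,p,q),(p,0,q)\}$, $\{(p,q,0),(0,q,p)\}$, $\{(q,0,p),(q,p,0)\}$ for all $p,q$ with $0>p>q$ and $p+q\in\{-N-1,-N-2\}$; $\{(0,p,p),(p,0,p),(p,p,0)\}$ for $2p\in\{-N-1,-N-2\}$; and $\{(0,0,q)\},\{(0,q,0)\},\{(q,0,0)\}$ for $q\le -N-1$. For such a grove, $m(G)=\prod_{e_a(i,j,k)\in E(G)}a_{j,k}\prod_{e_b(i,j,k)\in E(G)}b_{i,k}\prod_{e_c(i,j,k)\in E(G)}c_{i,j}\prod_{(i,j,k)\in\mathcal{I}}x_{i,j,k}^{\deg_G(i,j,k)-2}$ (a finite Laurent monomial).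
   Formalization: In the Connectivity condition only those listed vertex sets contained in I are counted; this is automatic for N ≥ -1, and it mends the case L = C(0,0,0), N ≤ -2, where {(0,0,1)} would otherwise have to lie in a component and no grove would exist. *)

(* Defs.v *)
From HB Require Import structures.
From mathcomp Require Import all_boot all_order all_algebra.
From mathcomp Require Import finmap.
From mathcomp Require Import boolp classical_sets cardinality fsbigop.
From mathcomp.multinomials Require Import monalg.
From mathcomp Require Import zify.
From Stdlib Require Import Relation_Operators.

Set Implicit Arguments.
Unset Strict Implicit.
Unset Printing Implicit Defensive.

Import Order.TTheory GRing.Theory Num.Theory.

Local Open Scope classical_set_scope.
Local Open Scope ring_scope.

(* Polynomials with integer coefficients in the variables v : V, where V may be
   infinite.  The library does not provide the integral domain structure, which
   is needed to form {fraction _}. *)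
Definition intpoly (V : choiceType) := {malg int[{cmonom V}]}.

Section IntPoly.
Variable V : choiceType.

HB.instance Definition _ := GRing.ComNzRing.copy (intpoly V) {malg int[{cmonom V}]}.

(* Base-B weight of a monomial; [kmon] is the corresponding Kronecker substitution. *)
Definition kexp (s : seq V) (B : nat) (m : {cmonom V}) : nat :=
  foldr (fun v acc => (m v + B * acc)%N) 0%N s.

Lemma kexp1 s B : kexp s B (mone : {cmonom V}) = 0%N.
Proof. by elim: s => //= v s ->; rewrite cm1 muln0. Qed.

Lemma kexpM s B (m1 m2 : {cmonom V}) :
  kexp s B (mmul m1 m2) = (kexp s B m1 + kexp s B m2)%N.
Proof. by elim: s => //= v s ->; rewrite cmM mulnDr; lia. Qed.

Lemma kexp_inj s B (m1 m2 : {cmonom V}) :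
    (forall v, m1 v < B)%N -> (forall v, m2 v < B)%N ->
    kexp s B m1 = kexp s B m2 -> forall v, v \in s -> m1 v = m2 v.
Proof.
move=> b1 b2; elim: s => //= u s IHs E v.
have Bgt0 : (0 < B)%N by apply: leq_ltn_trans (b1 u).
have Em : m1 u = m2 u.
  have := congr1 (modn^~ B) E.
  by rewrite ![(_ + B * _)%N]addnC ![(B * _)%N]mulnC !modnMDl !modn_small.
rewrite inE => /predU1P [->//|]; apply: IHs.
by move: E; rewrite Em => /addnI /eqP; rewrite eqn_pmul2l // => /eqP.
Qed.

Definition kmon s B (m : {cmonom V}) : {poly int} := 'X^(kexp s B m).

Lemma kmon_mmorphism s B : mmorphism (kmon s B).
Proof.
by split=> [m1 m2|]; rewrite /kmon ?kexp1 ?expr0 // kexpM exprD.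
Qed.

HB.instance Definition _ s B :=
  isMultiplicative.Build {cmonom V} {poly int} (kmon s B) (kmon_mmorphism s B).

Lemma mmap_kmon_eq0 s B (p : {malg int[{cmonom V}]}) :
    (forall m, m \in msupp p -> forall v, (m v < B)%N) ->
    (forall m, m \in msupp p -> forall v, v \notin s -> m v = 0%N) ->
  mmap (@polyC int) (kmon s B) p = 0 -> p = 0.
Proof.
move=> bB bs E; apply/malgP => m; rewrite mcoeff0.
case: (msuppP p m) => // mp.
have := congr1 (fun q : {poly int} => q`_(kexp s B m)) E.
rewrite mmapE coef_sum coef0 (big_fsetD1 m) //= coefCM coefXn eqxx mulr1.
rewrite big_seq big1 ?addr0 // => m'; rewrite in_fsetD1 => /andP[nm m'p].
rewrite coefCM coefXn; case: eqP => [Ek|_]; last by rewrite mulr0.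
case/eqP: nm; apply/eqP/cmP => v.
case: (boolP (v \in s)) => vs; last by rewrite !bs.
by apply: (kexp_inj (s := s) (B := B)) => //; [exact: bB|exact: bB].
Qed.

Lemma intpoly_mulf_eq0 (p q : {malg int[{cmonom V}]}) :
  p * q = 0 -> (p == 0) || (q == 0).
Proof.
move=> pq0.
pose ms : seq {cmonom V} := (msupp p : seq _) ++ (msupp q : seq _).
pose s : seq V := flatten (map (fun m : {cmonom V} => finsupp m : seq V) ms).
pose B := (\sum_(m <- ms) mdeg m).+1.
have bs (m : {cmonom V}) v : m \in ms -> v \notin s -> m v = 0%N.
  move=> mms vs; apply/eqP; rewrite cmE_eq0; apply: contra vs => vm.
  by apply/flattenP; exists (finsupp m : seq V) => //; exact: map_f.
have bB (m : {cmonom V}) v : m \in ms -> (m v < B)%N.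
  move=> mms; rewrite ltnS (big_rem m) //=.
  apply: leq_trans (leq_addr _ _).
  case: (mdomP m v) => // vm.
  by rewrite mdegE (big_fsetD1 v) //= leq_addr.
have inp m : m \in msupp p -> m \in ms by move=> h; rewrite mem_cat h.
have inq m : m \in msupp q -> m \in ms by move=> h; rewrite mem_cat h orbT.
have : mmap (@polyC int) (kmon s B) (p * q) = 0 by rewrite pq0 raddf0.
rewrite rmorphM => /eqP; rewrite mulf_eq0 => /orP[] /eqP h0.
  apply/orP; left; apply/eqP; apply: mmap_kmon_eq0 h0.
    by move=> m /inp /bB.
  by move=> m /inp mp v; apply: bs.
apply/orP; right; apply/eqP; apply: mmap_kmon_eq0 h0.
  by move=> m /inq /bB.
by move=> m /inq mq v; apply: bs.
Qed.

Definition intpoly_unit : {pred intpoly V} := [pred p | `[< exists q, q * p = 1 >]].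

Definition intpoly_inv (p : intpoly V) : intpoly V :=
  if pselect (exists q, q * p = 1) is left ex then sval (cid ex) else p.

Lemma intpoly_mulVp : {in intpoly_unit, left_inverse 1 intpoly_inv *%R}.
Proof.
move=> p /asboolP ex; rewrite /intpoly_inv; case: pselect => // ex'.
by case: cid.
Qed.

Lemma intpoly_unitP (p q : intpoly V) : q * p = 1 -> intpoly_unit p.
Proof. by move=> E; apply/asboolP; exists q. Qed.

Lemma intpoly_invr_out : {in [predC intpoly_unit], intpoly_inv =1 id}.
Proof.
move=> p /asboolP nex; rewrite /intpoly_inv; by case: pselect.
Qed.

HB.instance Definition _ := GRing.ComNzRing_hasMulInverse.Build (intpoly V)
  intpoly_mulVp intpoly_unitP intpoly_invr_out.
HB.instance Definition _ :=
  GRing.ComUnitRing_isIntegral.Build (intpoly V) intpoly_mulf_eq0.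

End IntPoly.

Inductive variable :=
  | varx of int & int & int
  | vara of int & int
  | varb of int & int
  | varc of int & int.

HB.instance Definition _ := gen_eqMixin variable.
HB.instance Definition _ := gen_choiceMixin variable.

(* Rational functions in all the variables; the coefficient ring does not
   matter, since the fraction fields of the polynomial rings over int and over
   rat coincide. *)
Definition ratfun : fieldType := {fraction (intpoly variable)}.

Definition var (v : variable) : ratfun := tofrac (mkmalgU (ucm v) 1 : intpoly variable).

Definition Z3 : Type := int * int * int.

Definition cone (p : Z3) : set Z3 :=
  let: (i, j, k) := p in
  [set q | let: (i', j', k') := q in [/\ i' <= i, j' <= j & k' <= k]].

Definition order_ideal (L : set Z3) : Prop :=
  forall p, L p -> cone p `<=` L.

Definition upper (L : set Z3) : set Z3 := ~` L.

Definition initial (L : set Z3) : set Z3 :=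
  [set p | L p /\ let: (i, j, k) := p in upper L (i + 1, j + 1, k + 1)].

Definition avar (j k : int) : ratfun := var (vara j k).
Definition bvar (i k : int) : ratfun := var (varb i k).
Definition cvar (i j : int) : ratfun := var (varc i j).
Definition xvar (p : Z3) : ratfun := let: (i, j, k) := p in var (varx i j k).

Definition cube_step (f : Z3 -> ratfun) (p : Z3) : ratfun :=
  let: (i, j, k) := p in
  (bvar i k * cvar i j * f (i - 1, j, k) * f (i, j - 1, k - 1)
   + cvar i j * avar j k * f (i, j - 1, k) * f (i - 1, j, k - 1)
   + avar j k * bvar i k * f (i, j, k - 1) * f (i - 1, j - 1, k))
  / f (i - 1, j - 1, k - 1).

Fixpoint cube_iter (L : set Z3) (n : nat) (p : Z3) : ratfun :=
  if p \in initial L then xvar p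
  else if n is n'.+1 then cube_step (cube_iter L n') p else 0.

(* The functions f_{i,j,k}: the number of points of [upper L] below p bounds the
   depth of the recursion at p.  The value is only meaningful on [initial L] and
   at those p in [upper L] for which [cone p `&` upper L] is finite, where
   [cube_f_initial] and [cube_f_upper] below characterize it. *)
Definition cube_f (L : set Z3) (p : Z3) : ratfun :=
  cube_iter L #|` fset_set (cone p `&` upper L)| p.

Section CubeRecurrence.
Variable L : set Z3.
Hypothesis idL : order_ideal L.

Let dom (p : Z3) :=
  initial L p \/ (upper L p /\ finite_set (cone p `&` upper L)).
Let card (p : Z3) := #|` fset_set (cone p `&` upper L)|.

Lemma cube_f_initial p : initial L p -> cube_f L p = xvar p.
Proof.
by move=> Ip; rewrite /cube_f; case: #|`_|%fset => [|n] /=; rewrite mem_set.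
Qed.

Let cone_refl p : cone p p.
Proof. by case: p => [[i j] k]; split. Qed.

Let cone_trans p q : cone p q -> cone q `<=` cone p.
Proof.
move: p q => [[i j] k] [[i' j'] k'] [h1 h2 h3] [[i2 j2] k2] [g1 g2 g3].
by split; [apply: le_trans h1|apply: le_trans h2|apply: le_trans h3].
Qed.

(* q ranges over the points used in the recurrence at p *)
Let below (p q : Z3) : Prop :=
  let: (i, j, k) := p in let: (i', j', k') := q in
  [/\ i - 1 <= i' <= i, j - 1 <= j' <= j, k - 1 <= k' <= k & p <> q].

Let below_dom p q : upper L p -> finite_set (cone p `&` upper L) ->
  below p q -> dom q /\ (card q < card p)%N.
Proof.
move: p q => [[i j] k] [[i' j'] k'] Up fp [/andP[h1 g1] /andP[h2 g2] /andP[h3 g3]] ne.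
have sub : cone (i', j', k') `&` upper L `<=` cone (i, j, k) `&` upper L.
  by move=> r [cr Ur]; split=> //; apply: cone_trans cr; split.
have fq := sub_finite_set sub fp.
split.
  case: (pselect (L (i', j', k'))) => [Lq|Uq]; last by right.
  left; split=> // Lq1; apply: Up; apply: (idL Lq1); split; lia.
apply: fproper_ltn_card; apply/andP; split; first by rewrite -fset_set_sub.
apply/negP => /fsubsetP /(_ (i, j, k)).
rewrite !in_fset_set // !inE => /(_ (conj (cone_refl _) Up)) [[q1 q2 q3] _].
by apply: ne; congr (_, _, _); lia.
Qed.

Let cube_iter_stable n m p : dom p -> (card p <= n)%N -> (card p <= m)%N ->
  cube_iter L n p = cube_iter L m p.
Proof.
elim: n m p => [|n IHn] m p dp cn cm.
- case: dp => [Ip|[Up fp]]; first by case: m {cm} => [|m] /=; rewrite mem_set.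
  suff : (0 < card p)%N by rewrite ltnNge cn.
  rewrite cardfs_gt0; apply/fset0Pn; exists p.
  by rewrite in_fset_set // inE; split.
case: dp => [Ip|[Up fp]]; first by case: m {cm} => [|m] /=; rewrite mem_set.
have c0 : (0 < card p)%N.
  rewrite cardfs_gt0; apply/fset0Pn; exists p.
  by rewrite in_fset_set // inE; split.
case: m cm => [|m] cm; first by rewrite leqNgt c0 in cm.
rewrite /=; case: ifP => // _.
have E q : below p q -> cube_iter L n q = cube_iter L m q.
  by move=> /(below_dom Up fp) [dq lq]; apply: IHn => //; lia.
move: p {c0 cn cm Up fp} E => [[i j] k] E /=.
by rewrite !E //; split; try (by lia); case; lia.
Qed.

Lemma cube_f_upper p : upper L p -> finite_set (cone p `&` upper L) ->
  cube_f L p = cube_step (cube_f L) p.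
Proof.
move=> Up fp; have nIp : (p \in initial L) = false.
  by apply/negbTE; apply/negP; rewrite inE => -[].
have E n q : (card p <= n.+1)%N -> below p q -> cube_iter L n q = cube_f L q.
  move=> cn /(below_dom Up fp) [dq lq].
  by apply: cube_iter_stable => //; rewrite -ltnS; apply: leq_trans cn.
rewrite {1}/cube_f -/(card p); case En : (card p) => [|n].
  suff : (0 < card p)%N by rewrite En.
  rewrite cardfs_gt0; apply/fset0Pn; exists p.
  by rewrite in_fset_set // inE; split.
have {}E q := E n q (eq_leq En).
rewrite /= nIp; move: p {En Up fp nIp} E => [[i j] k] E /=.
by rewrite !E //; split; try (by lia); case; lia.
Qed.

End CubeRecurrence.

Definition cutoff (L : set Z3) (N : int) : Prop :=
  (forall i j k : int, i + j + k <= - N -> Num.max i (Num.max j k) = 0 ->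
     initial L (i, j, k)) /\
  (forall i j k : int, i + j + k <= - N - 3 -> Num.max i (Num.max j k) < 0 ->
     ~ initial L (i, j, k)).

Inductive axis := axis_a | axis_b | axis_c.

Definition rhombus_at (d : axis) (p : Z3) : set Z3 :=
  let: (i, j, k) := p in
  match d with
  | axis_a => [set (i, j, k); (i, j - 1, k); (i, j, k - 1); (i, j - 1, k - 1)]
  | axis_b => [set (i, j, k); (i - 1, j, k); (i, j, k - 1); (i - 1, j, k - 1)]
  | axis_c => [set (i, j, k); (i - 1, j, k); (i, j - 1, k); (i - 1, j - 1, k)]
  end.

Definition is_rhombus (L : set Z3) (d : axis) (p : Z3) : Prop :=
  rhombus_at d p `<=` initial L.

Definition long_edge (d : axis) (p : Z3) : set Z3 :=
  let: (i, j, k) := p in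
  match d with
  | axis_a => [set (i, j - 1, k); (i, j, k - 1)]
  | axis_b => [set (i - 1, j, k); (i, j, k - 1)]
  | axis_c => [set (i - 1, j, k); (i, j - 1, k)]
  end.

Definition short_edge (d : axis) (p : Z3) : set Z3 :=
  let: (i, j, k) := p in
  match d with
  | axis_a => [set (i, j, k); (i, j - 1, k - 1)]
  | axis_b => [set (i, j, k); (i - 1, j, k - 1)]
  | axis_c => [set (i, j, k); (i - 1, j - 1, k)]
  end.

(* An edge is the set of its two endpoints. *)
Record graph := Graph { vertices : set Z3; edges : set (set Z3) }.

HB.instance Definition _ := gen_eqMixin graph.
HB.instance Definition _ := gen_choiceMixin graph.

Definition subgraph (G H : graph) : Prop :=
  [/\ vertices G `<=` vertices H, edges G `<=` edges H
    & forall e, edges G e -> e `<=` vertices G].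

Definition rhombus_graph (L : set Z3) : graph :=
  Graph (initial L)
    [set e | exists d p, is_rhombus L d p /\ (e = long_edge d p \/ e = short_edge d p)].

Definition adjacent (G : graph) (u v : Z3) : Prop := edges G [set u; v].

Definition component (G : graph) (v : Z3) : set Z3 :=
  [set w | clos_refl_trans Z3 (adjacent G) v w].

Definition degree (G : graph) (v : Z3) : nat :=
  #|` fset_set (edges G `&` [set e | e v])|.

(* The vertex sets of the connectivity condition.  The clause [S `<=` initial L]
   holds automatically for a cutoff N >= -1.  It matters only for L = cone (0,0,0),
   which admits every integer N as a cutoff: for N <= -2 the list also produces
   sets such as {(0,0,1)} that contain points outside the vertex set. *)
Definition boundary_set (L : set Z3) (N : int) (S : set Z3) : Prop :=
  S `<=` initial L /\
  [\/ exists p q : int,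
        [/\ 0 > p, p > q, (p + q = - N - 1 \/ p + q = - N - 2)
          & [\/ S = [set (0, p, q); (p, 0, q)], S = [set (p, q, 0); (0, q, p)]
              | S = [set (q, 0, p); (q, p, 0)]]],
      exists2 p : int, (2 * p = - N - 1 \/ 2 * p = - N - 2)
          & S = [set (0, p, p); (p, 0, p); (p, p, 0)]
    | exists2 q : int, q <= - N - 1
          & [\/ S = [set (0, 0, q)], S = [set (0, q, 0)] | S = [set (q, 0, 0)]]].

Definition complete (L : set Z3) (G : graph) : Prop := vertices G = initial L.

Definition complementary (L : set Z3) (G : graph) : Prop :=
  forall d p, is_rhombus L d p ->
    (edges G (long_edge d p) /\ ~ edges G (short_edge d p)) \/
    (~ edges G (long_edge d p) /\ edges G (short_edge d p)).

Definition compact_within (L : set Z3) (N : int) (G : graph) : Prop :=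
  forall d p, is_rhombus L d p ->
    (forall i j k, rhombus_at d p (i, j, k) -> i + j + k < - N) ->
    edges G (short_edge d p).

Definition connected_within (L : set Z3) (N : int) (G : graph) : Prop :=
  (forall v, vertices G v ->
     exists! S, boundary_set L N S /\ S `<=` component G v) /\
  (forall S, boundary_set L N S ->
     exists2 v, vertices G v & S `<=` component G v).

Definition grove (L : set Z3) (N : int) (G : graph) : Prop :=
  [/\ subgraph G (rhombus_graph L), complete L G, complementary L G,
      compact_within L N G & connected_within L N G].

Definition edge_var (d : axis) (p : Z3) : ratfun :=
  let: (i, j, k) := p in
  match d with axis_a => avar j k | axis_b => bvar i k | axis_c => cvar i j end.

(* m(G); the products run over infinite index sets, but all but finitely many
   factors are 1. *)
Definition grove_monomial (L : set Z3) (G : graph) : ratfun :=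
  (\big[*%R/1]_(p \in [set p | edges G (long_edge axis_a p)]) edge_var axis_a p)
  * (\big[*%R/1]_(p \in [set p | edges G (long_edge axis_b p)]) edge_var axis_b p)
  * (\big[*%R/1]_(p \in [set p | edges G (long_edge axis_c p)]) edge_var axis_c p)
  * (\big[*%R/1]_(p \in initial L) xvar p ^ ((degree G p)%:Z - 2)).

(* Main.v *)
(**
  Induction on the number of points of [upper L] in the octant
  [C0 = cone (0,0,0)], adding to [L] a minimal such point w = (i,j,k).  This
  replaces v = w - (1,1,1) by w in the initial set, and the three rhombi around v
  by the three rhombi around w; both triples tile the same hexagon.  For a fixed
  configuration outside the hexagon, v of degree 3 matches w of degree 1 (three
  choices), degree 1 matches degree 3, and for degree 2 the rhombus with the long
  edge is the same on both sides; matching choices connect the six rim vertices in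
  the same way, so they are groves simultaneously, and their total weights agree by
  f(w) f(v) = b c f(A) f(A') + c a f(B) f(B') + a b f(C) f(C').

  No substitution into rational functions takes place: all the weights are taken at
  the values of the single function [cube_f L], for the original L, which never
  vanish because they are quotients of polynomials whose coefficient sum is positive.

  For L = C0 all the edges of a grove are short: a long edge farthest from the
  origin would join two chains of short edges that end in different boundary sets.
*)
From HB Require Import structures.
Require Import Defs.
From mathcomp Require Import all_boot all_order all_algebra.
From mathcomp Require Import finmap.
From mathcomp Require Import boolp classical_sets cardinality fsbigop.
From mathcomp Require Import zify.
From mathcomp.multinomials Require Import monalg.
From mathcomp.algebra_tactics Require Import ring.
From Stdlib Require Import Relation_Operators.

Set Implicit Arguments.
Unset Strict Implicit.
Unset Printing Implicit Defensive.

Import Order.TTheory GRing.Theory Num.Theory.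

Local Open Scope classical_set_scope.
Local Open Scope ring_scope.

HB.instance Definition _ := gen_eqMixin axis.
HB.instance Definition _ := gen_choiceMixin axis.

(** * Groves as sets of rhombi *)

Lemma set2_eq (T : Type) (a b c d : T) :
  [set a; b] = [set c; d] -> (a = c /\ b = d) \/ (a = d /\ b = c).
Proof.
move=> E.
have : [set c; d] a by rewrite -E; left.
have : [set c; d] b by rewrite -E; right.
have : [set a; b] c by rewrite E; left.
have : [set a; b] d by rewrite E; right.
by move=> /= [] ? [] ? [] ? [] ?; subst; auto.
Qed.

Notation rhomb := (axis * Z3)%type.

Definition long1 (x : rhomb) : Z3 :=
  let: (d, (i, j, k)) := x in
  match d with axis_a => (i, j - 1, k) | axis_b => (i - 1, j, k) | axis_c => (i - 1, j, k) end.
Definition long2 (x : rhomb) : Z3 :=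
  let: (d, (i, j, k)) := x in
  match d with axis_a => (i, j, k - 1) | axis_b => (i, j, k - 1) | axis_c => (i, j - 1, k) end.
Definition short2 (x : rhomb) : Z3 :=
  let: (d, (i, j, k)) := x in
  match d with
  | axis_a => (i, j - 1, k - 1) | axis_b => (i - 1, j, k - 1) | axis_c => (i - 1, j - 1, k)
  end.

(** [S] collects the rhombi that contribute their long edge. A rhombus is named by its direction and
    its highest corner, which is also the first end of its short edge. *)
Definition end1 (S : set rhomb) x : Z3 := if `[< S x >] then long1 x else x.2.
Definition end2 (S : set rhomb) x : Z3 := if `[< S x >] then long2 x else short2 x.

Definition chosen (S : set rhomb) x : set Z3 := [set end1 S x; end2 S x].

Definition rhombi (L : set Z3) : set rhomb := [set x | is_rhombus L x.1 x.2].

Lemma chosen_long S x : S x -> chosen S x = long_edge x.1 x.2.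
Proof.
by move=> Sx; rewrite /chosen /end1 /end2 asboolT //; case: x Sx => [[] [[i j] k]].
Qed.

Lemma chosen_short S x : ~ S x -> chosen S x = short_edge x.1 x.2.
Proof.
by move=> Sx; rewrite /chosen /end1 /end2 asboolF //; case: x Sx => [[] [[i j] k]].
Qed.

Lemma ends_neq S x : end1 S x <> end2 S x.
Proof.
by rewrite /end1 /end2; case: asboolP => _; case: x => [[] [[i j] k]] /= []; lia.
Qed.

(* The direction of an edge tells its type and whether it is long or short. *)
Lemma chosen_inj S S' x y : chosen S x = chosen S' y -> x = y /\ (S x <-> S' y).
Proof.
rewrite /chosen => E; have {E} := set2_eq E; rewrite /end1 /end2.
case: asboolP => Sx; case: asboolP => Sy;
  case: x Sx => [[] [[i j] k]] Sx; case: y Sy => [[] [[i' j'] k']] Sy;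
  move=> [] [] [] ? ? ? [] ? ? ?; try (by exfalso; lia);
  (split; [by congr (_, (_, _, _)); lia | by split]).
Qed.

Lemma chosen_sub_rhombus S x : chosen S x `<=` rhombus_at x.1 x.2.
Proof.
rewrite /chosen /end1 /end2 => q; case: asboolP => _; case: x => [[] [[i j] k]] /= [] ->;
  rewrite /set1 /setU /=; tauto.
Qed.

(** Complementarity makes a grove a choice of one edge per rhombus. Here it holds by construction,
    so only compactness and connectivity remain as conditions on [S]. *)
Definition graph_of (L : set Z3) (S : set rhomb) : graph :=
  Graph (initial L) [set e | exists2 x, rhombi L x & e = chosen S x].

Lemma edges_long L S x :
  edges (graph_of L S) (long_edge x.1 x.2) <-> rhombi L x /\ S x.
Proof.
have E : chosen setT x = long_edge x.1 x.2 by apply: chosen_long.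
rewrite -E; split=> [[y Ry /chosen_inj [-> h]]|[Rx Sx]].
  by split=> //; apply/h.
by exists x => //; rewrite E chosen_long.
Qed.

Lemma edges_short L S x :
  edges (graph_of L S) (short_edge x.1 x.2) <-> rhombi L x /\ ~ S x.
Proof.
have E : chosen set0 x = short_edge x.1 x.2 by apply: chosen_short.
rewrite -E; split=> [[y Ry /chosen_inj [-> h]]|[Rx Sx]].
  by split=> //; rewrite -h.
by exists x => //; rewrite E chosen_short.
Qed.

Definition longs (G : graph) : set rhomb := [set x | edges G (long_edge x.1 x.2)].

Lemma longs_graph_of L S : S `<=` rhombi L -> longs (graph_of L S) = S.
Proof.
move=> SR; apply/seteqP; split=> x; first by move/edges_long => [].
by move=> Sx; apply/edges_long; split=> //; apply: SR.
Qed.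

Lemma graph_of_longs L N G : grove L N G -> graph_of L (longs G) = G.
Proof.
move=> [[_ sE _] cG kG _ _]; case: G sE cG kG => V E /= sE cG kG.
move: cG; rewrite /complete /= => ->; congr Graph; apply/seteqP; split=> e /=.
  case=> x Rx ->; case: (kG x.1 x.2 Rx) => /= -[h1 h2].
    by rewrite chosen_long.
  by rewrite chosen_short.
move=> Ee; have [d [p [Rx h]]] := sE e Ee; exists (d, p) => //.
case: (kG d p Rx) => /= -[h1 h2]; case: h => h; subst e => //.
- by rewrite chosen_long.
- by rewrite chosen_short.
Qed.

Definition conf_compact (N : int) (R S : set rhomb) : Prop :=
  forall x, R x ->
    (forall i j k, rhombus_at x.1 x.2 (i, j, k) -> i + j + k < - N) -> ~ S x.

Definition grove_conf (L : set Z3) (N : int) (S : set rhomb) : Prop :=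
  [/\ S `<=` rhombi L, conf_compact N (rhombi L) S & connected_within L N (graph_of L S)].

Lemma longs_sub L N G : grove L N G -> longs G `<=` rhombi L.
Proof.
move=> [[_ sE _] _ _ _ _] x /sE [d [p [Rx h]]].
(* With [S] everything or nothing, either edge of [(d, p)] is a chosen one, and [chosen_inj] then
   identifies the rhombus. *)
have {h} [S h] : exists S, long_edge x.1 x.2 = chosen S (d, p).
  by case: h => ->; [exists setT; rewrite chosen_long|exists set0; rewrite chosen_short].
by move: h; rewrite -(@chosen_long setT) // => /chosen_inj [-> _].
Qed.

Lemma grove_graph_of L N S : S `<=` rhombi L ->
  grove L N (graph_of L S) <-> grove_conf L N S.
Proof.
move=> SR; split=> [[_ _ _ cp cn]|[_ cp cn]].
  by split=> // x Rx /(cp _ _ Rx) /edges_short [].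
split=> //.
- split=> //= e.
    case=> x Rx ->; exists x.1, x.2; split=> //.
    by case: (pselect (S x)) => h; [left; rewrite chosen_long|right; rewrite chosen_short].
  by case=> x Rx -> q /chosen_sub_rhombus; apply: Rx.
- move=> d p Rx; rewrite !(@edges_long L S (d, p)) !(@edges_short L S (d, p)).
  by case: (pselect (S (d, p))) => h; [left|right]; split=> //; case.
- move=> d p Rx h; apply/(@edges_short L S (d, p)); split=> //.
  exact: (cp (d, p) Rx h).
Qed.

Lemma sum_groves L N (F : graph -> ratfun) :
  \sum_(G \in [set G | grove L N G]) F G
    = \sum_(S \in [set S | grove_conf L N S]) F (graph_of L S).
Proof.
apply: reindex_fsbig; split.
- by move=> S /= gS; apply/grove_graph_of => //; case: gS.
- move=> S S'; rewrite !inE => -[SR _ _] [SR' _ _] E.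
  by rewrite -(longs_graph_of SR) E longs_graph_of.
- move=> G /= gG; exists (longs G); last exact: graph_of_longs gG.
  apply/grove_graph_of; first exact: longs_sub gG.
  by rewrite (graph_of_longs gG).
Qed.

Definition incident (R S : set rhomb) (v : Z3) : set rhomb := [set x | R x /\ chosen S x v].

(** A point is a corner of at most four rhombi in each of the three directions. *)
Lemma finite_incident R S v : finite_set (incident R S v).
Proof.
case: v => [[i j] k].
pose c : seq rhomb :=
  [:: (axis_a, (i, j, k)); (axis_b, (i, j, k)); (axis_c, (i, j, k));
      (axis_a, (i, j + 1, k)); (axis_a, (i, j, k + 1)); (axis_a, (i, j + 1, k + 1));
      (axis_b, (i + 1, j, k)); (axis_b, (i, j, k + 1)); (axis_b, (i + 1, j, k + 1));
      (axis_c, (i + 1, j, k)); (axis_c, (i, j + 1, k)); (axis_c, (i + 1, j + 1, k))].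
apply: (@sub_finite_set _ _ [set` c]); last exact: finite_seq.
move=> x [_ /chosen_sub_rhombus]; rewrite /= /c !inE.
have T (d : axis) (i1 j1 k1 i2 j2 k2 : int) : i1 = i2 -> j1 = j2 -> k1 = k2 ->
    (d, (i1, j1, k1)) == (d, (i2, j2, k2)) :> rhomb.
  by move=> -> -> ->.
case: x => [[] [[i' j'] k']] /=; rewrite /set1 /setU /= => -[[[]|]|] [] h1 h2 h3;
  repeat (apply/orP; (left; apply: T; lia) || right); apply: T; lia.
Qed.

(** The set [R] of rhombi is a parameter, so that rhombi can be adjoined one at a time when weights
    are compared. *)
Definition deg (R S : set rhomb) (v : Z3) : nat := #|` fset_set (incident R S v)|.

Lemma degree_graph_of L S v : degree (graph_of L S) v = deg (rhombi L) S v.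
Proof.
have E : edges (graph_of L S) `&` [set e | e v] = chosen S @` incident (rhombi L) S v.
  apply/seteqP; split=> e /=.
    by case=> -[x Rx ->] xv; exists x.
  by case=> x [Rx xv] <-; split=> //; exists x.
rewrite /degree E fset_set_image; last exact: finite_incident.
by apply: card_imfset => x y /chosen_inj [].
Qed.

Lemma deg_setU1 R S x v : ~ R x -> deg (x |` R) S v = (`[< chosen S x v >] + deg R S v)%N.
Proof.
move=> nRx; rewrite /deg; case: asboolP => h.
  have -> : incident (x |` R) S v = x |` incident R S v.
    apply/seteqP; split=> y /=; first by case=> -[-> _|Ry yv]; [left|right].
    by case=> [->|[Ry yv]]; split=> //; [left|right].
  rewrite fset_setU1; last exact: finite_incident.
  rewrite cardfsU1 in_fset_set; last exact: finite_incident.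
  by case: (boolP (x \in _)) => //; rewrite inE => -[].
rewrite add0n; congr (#|` fset_set _|); apply/seteqP; split=> y /=.
  by case=> -[-> //|Ry yv].
by case=> Ry yv; split=> //; right.
Qed.

Lemma eq_chosen S S' x : (S x <-> S' x) -> chosen S x = chosen S' x.
Proof.
by move=> h; rewrite /chosen /end1 /end2; have -> : `[< S x >] = `[< S' x >] by apply: asbool_equiv_eq.
Qed.

Lemma eq_deg R S S' v : (forall x, R x -> (S x <-> S' x)) -> deg R S v = deg R S' v.
Proof.
move=> h; congr (#|` fset_set _|); apply/seteqP; split=> y /= [Ry yv]; split=> //.
  by rewrite -(eq_chosen (h y Ry)).
by rewrite (eq_chosen (h y Ry)).
Qed.

(** * Weights *)

Section Weights.
Variables (F : fieldType) (var : axis -> Z3 -> F) (f : Z3 -> F).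

Definition vertex_weight (I : set Z3) (R S : set rhomb) : F :=
  \big[*%R/1]_(p \in I) f p ^ ((deg R S p)%:Z - 2).

Definition edge_weight (d : axis) (S : set rhomb) : F :=
  \big[*%R/1]_(p \in [set p | S (d, p)]) var d p.

Definition weight (I : set Z3) (R S : set rhomb) : F :=
  edge_weight axis_a S * edge_weight axis_b S * edge_weight axis_c S * vertex_weight I R S.

(** A product over a set with infinite support takes the default value 1. These two conditions keep
    the supports of the edge and vertex products finite. *)
Definition tame (I : set Z3) (R S : set rhomb) : Prop :=
  finite_set S /\ finite_set (I `&` [set p | deg R S p <> 2%N]).

(** Off the finite set [A] all factors are 1, so the three products reduce to finite ones over [I]
    intersected with [A]. *)
Lemma fsprod_mul (T : choiceType) (I : set T) (A : set T) (g h : T -> F) :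
  finite_set A -> (forall p, I p -> ~ A p -> g p = 1 /\ h p = 1) ->
  \big[*%R/1]_(p \in I) (g p * h p)
    = (\big[*%R/1]_(p \in I) g p) * (\big[*%R/1]_(p \in I) h p).
Proof.
move=> fA gh.
have E K : (forall p, I p -> ~ A p -> K p = 1) ->
    \big[*%R/1]_(p \in I) K p = \big[*%R/1]_(p \in I `&` A) K p :> F.
  move=> hK; symmetry; apply: fsbig_widen; first by move=> ? [].
  by move=> p [Ip nA] /=; apply: hK => // Ap; apply: nA.
rewrite !E; [|by move=> p Ip /(gh _ Ip) []|by move=> p Ip /(gh _ Ip) []|].
  by rewrite fsbig_split //; apply: finite_setIr.
by move=> p Ip /(gh _ Ip) [-> ->]; rewrite mulr1.
Qed.

(** Presents a single factor as a product over [I], so that [fsprod_mul] can absorb it pointwise. *)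
Lemma fsprod_delta (T : choiceType) (I : set T) (q : T) (c : F) :
  I q -> \big[*%R/1]_(p \in I) (if p == q then c else 1) = c.
Proof.
move=> Iq; rewrite -(@fsbig_widen _ _ _ _ [set q]).
- by rewrite fsbig_set1 eqxx.
- by move=> ? ->.
- by move=> p [_ /eqP] /=; case: eqP.
Qed.

(** Degrees change only at the two ends of the chosen edge. *)
Lemma tame_setU1 I R S x : ~ R x -> tame I R S <-> tame I (x |` R) S.
Proof.
move=> nRx.
have h p : ~ chosen S x p -> deg (x |` R) S p = deg R S p.
  by move=> nc; rewrite deg_setU1 // asboolF.
have fc : finite_set (chosen S x) by apply: finite_set2.
have fU A : finite_set A -> finite_set (A `|` chosen S x) by move=> fA; rewrite finite_setU.
split=> -[fS fI]; split=> //; apply: sub_finite_set (fU _ fI) => p [Ip /= dp];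
  case: (pselect (chosen S x p)) => [|/h e]; [by right|left|by right|left];
  by split=> //=; rewrite ?e // -e.
Qed.

(** The chosen edge adds one to the exponent at each of its two distinct ends. Nonvanishing of [f]
    allows exponents, which may be negative, to be added. *)
Lemma vertex_weight_setU1 I R S x : ~ R x -> chosen S x `<=` I -> tame I R S ->
  (forall p, I p -> f p != 0) ->
  vertex_weight I (x |` R) S = f (end1 S x) * f (end2 S x) * vertex_weight I R S.
Proof.
move=> nRx cI [_ fI] f0.
rewrite /vertex_weight.
have I1 : I (end1 S x) by apply: cI; left.
have I2 : I (end2 S x) by apply: cI; right.
have fc : finite_set (chosen S x) by apply: finite_set2.
rewrite -{1}(fsprod_delta (f (end1 S x)) I1) -{1}(fsprod_delta (f (end2 S x)) I2).
have nc p : ~ chosen S x p -> (p == end1 S x) = false /\ (p == end2 S x) = false.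
  by move=> h; split; apply/eqP => E; apply: h; [left|right].
rewrite -(@fsprod_mul _ _ (chosen S x)) //; last by move=> p _ /nc [-> ->].
rewrite -(@fsprod_mul _ _ (chosen S x `|` (I `&` [set p | deg R S p <> 2%N]))).
- apply: eq_fsbigr => p; rewrite inE => Ip; rewrite deg_setU1 //; case: asboolP => [h|/nc [-> ->]].
    rewrite PoszD -addrA [LHS]expfzDr ?f0 // -[Posz true]/(1 : int) expr1z; congr (_ * _).
    case: h => /= ->; rewrite eqxx.
      by case: eqP => [/ends_neq //|]; rewrite mulr1.
    by rewrite eq_sym; case: eqP => [/ends_neq //|]; rewrite mul1r.
  by rewrite add0n !mul1r.
- by rewrite finite_setU.
- move=> p Ip h; split.
    by have [-> ->] : (p == end1 S x) = false /\ (p == end2 S x) = false;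
      [apply: nc => ?; apply: h; left|rewrite mulr1].
  have -> : deg R S p = 2%N by apply: contrapT => n2; apply: h; right.
  by rewrite subrr expr0z.
Qed.

Lemma tame_vertex I R S v : tame I R S <-> tame (v |` I) R S.
Proof.
split=> -[fS fI]; split=> //.
  apply: (@sub_finite_set _ _ (v |` (I `&` [set p | deg R S p <> 2%N]))).
    by move=> p [[->|Ip] dp]; [left|right].
  by rewrite finite_setU.
by apply: sub_finite_set fI => p [Ip dp]; split=> //; right.
Qed.

Lemma vertex_weight_vertex I R S v : ~ I v -> tame I R S -> deg R S v = 0%N ->
  vertex_weight (v |` I) R S = f v ^ (-2) * vertex_weight I R S.
Proof.
move=> nv [fS fI] dv; rewrite /vertex_weight.
rewrite (fsbig_supp _ I) /=.
pose A := v |` (I `&` [set p | deg R S p <> 2%N]).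
have fA : finite_set A by rewrite finite_setU.
rewrite -(@fsbig_widen _ _ _ _ A).
- rewrite /A fsbigU0 //.
  + rewrite fsbig_set1 dv; congr (_ * _).
    rewrite -fsbig_supp; apply: fsbig_widen; first by move=> p [].
    move=> p [Ip h] /=.
    have -> : deg R S p = 2%N by apply: contrapT => n2; apply: h.
    by rewrite subrr expr0z.
  + by move=> p [-> []].
- by move=> p [->|[Ip _]]; [left|right].
- move=> p [[->|Ip] h] /=; first by case: h; left.
  have -> : deg R S p = 2%N by apply: contrapT => n2; apply: h; right.
  by rewrite subrr expr0z.
Qed.

Lemma edge_weight_setU1 d S x : finite_set S -> ~ S x ->
  edge_weight d (x |` S) = (if d == x.1 then var x.1 x.2 else 1) * edge_weight d S.
Proof.
move=> fS nx; rewrite /edge_weight.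
case: eqP => [E|ne]; last first.
  rewrite mul1r; apply: eq_fsbigl; apply/seteqP; split=> p /=; last by right.
  by case=> // h; case: ne; rewrite -h.
have -> : [set p | (x |` S) (d, p)] = x.2 |` [set p | S (d, p)].
  apply/seteqP; split=> p /=.
    by case=> [<-|]; [left|right].
  by case=> [->|]; [left; rewrite E; case: (x)|right].
rewrite fsbigU0 ?fsbig_set1 ?E //.
  have : finite_set (snd @` S) by apply: finite_image.
  by apply: sub_finite_set => p /= Sp; exists (x.1, p).
by move=> p [-> /=]; case: (x) nx.
Qed.

Lemma edge_weights_setU1 S x : finite_set S -> ~ S x ->
  edge_weight axis_a (x |` S) * edge_weight axis_b (x |` S) * edge_weight axis_c (x |` S)
  = var x.1 x.2 * (edge_weight axis_a S * edge_weight axis_b S * edge_weight axis_c S).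
Proof.
move=> fS nx; rewrite !edge_weight_setU1 //.
have E (d d' : axis) : d <> d' -> (d == d') = false by move/eqP/negbTE.
by case: x.1; rewrite !eqxx !E //; ring.
Qed.

End Weights.

(** * Connections through a hexagon *)

Section Hexagon.
Variable V : choiceType.

Definition link (a b u u' : V) : Prop := (u = a /\ u' = b) \/ (u = b /\ u' = a).

(* A star A, B, C around v with opposite rim vertices A', B', C'; each of the
   three rhombi contributes its rim edge or its spoke. *)
Definition star (K : V -> V -> Prop) (A B C A' B' C' v : V) (t : bool * bool * bool)
    (u u' : V) : Prop :=
  K u u' \/ (if t.1.1 then link B' C' u u' else link A v u u') \/
  (if t.1.2 then link A' C' u u' else link B v u u') \/
  (if t.2 then link A' B' u u' else link C v u u').

Definition long_count (t : bool * bool * bool) : nat := (t.1.1 + t.1.2 + t.2)%N.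

(* The configurations of a star and of the opposite star that induce the same
   connections between the rim vertices. *)
Definition matching (t s : bool * bool * bool) : bool :=
  ((long_count t + long_count s == 2)%N) && ((long_count t == 1)%N ==> (t == s)).

Lemma matching_sym t s : matching t s = matching s t.
Proof. by move: t s => [[[] []] []] [[[] []] []]. Qed.

(** Moving the hub [v] to a rim vertex joined to it turns each edge of the first star into a path of
    the second one, so whole paths between other vertices are transported. *)
Lemma star_sub (K : V -> V -> Prop) (A B C A' B' C' v w : V) t s :
  matching t s ->
  (forall u u', K u u' -> u <> v /\ u' <> v) ->
  [/\ A <> v, B <> v & C <> v] -> [/\ A' <> v, B' <> v & C' <> v] ->
  (forall u u', u <> v -> u' <> v ->
     clos_refl_trans V (star K A B C A' B' C' v t) u u' ->
     clos_refl_trans V (star K A' B' C' A B C w s) u u').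
Proof.
move=> ts Kv [nA nB nC] [nA' nB' nC'].
(* The end of the first spoke present. [matching] excludes three long edges, so the default [C] is
   reached only when its spoke is present. *)
have [h hE] : {h | h = if ~~ t.1.1 then A else if ~~ t.1.2 then B else C} by eexists.
pose phi u := if u == v then h else u.
have phiE u : u <> v -> phi u = u by rewrite /phi; case: eqP.
have phiv : phi v = h by rewrite /phi eqxx.
suff H u u' : clos_refl_trans V (star K A B C A' B' C' v t) u u' ->
    clos_refl_trans V (star K A' B' C' A B C w s) (phi u) (phi u').
  by move=> u u' nu nu' /H; rewrite !phiE.
elim=> {u u'}; last 2 first.
- by move=> x; apply: rt_refl.
- by move=> x y z _ h1 _ h2; apply: rt_trans h1 h2.
have lk a b x y : star K A' B' C' A B C w s a b -> star K A' B' C' A B C w s b a ->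
    link a b x y -> clos_refl_trans V (star K A' B' C' A B C w s) x y.
  by move=> h1 h2 [[-> ->]|[-> ->]]; apply: rt_step.
have lk2 a c b x y : star K A' B' C' A B C w s a c -> star K A' B' C' A B C w s c a ->
    star K A' B' C' A B C w s c b -> star K A' B' C' A B C w s b c ->
    link a b x y -> clos_refl_trans V (star K A' B' C' A B C w s) x y.
  by move=> h1 h2 h3 h4 [[-> ->]|[-> ->]]; apply: (rt_trans _ _ _ c); apply: rt_step.
have pl a b x y : link a b x y -> link (phi a) (phi b) (phi x) (phi y).
  by move=> [[-> ->]|[-> ->]]; [left|right].
have lr a x y : link a a x y -> clos_refl_trans V (star K A' B' C' A B C w s) x y.
  by move=> [[-> ->]|[-> ->]]; apply: rt_refl.
move=> x y [Kxy|[|[]]].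
- have [nx ny] := Kv _ _ Kxy; rewrite !phiE //; apply: rt_step; by left.
all: clearbody phi; move: phiv; rewrite hE => phiv; clear h hE.
all: move: t s ts lk lk2 lr phiv => [[[] []] []] [[[] []] []] //= _ lk lk2 lr phiv.
(* The image of an edge is trivial, an edge of the other star, or a path of two edges through [w] or
   through a rim vertex. *)
all: move=> /pl; rewrite ?phiv ?(phiE _ nA) ?(phiE _ nB) ?(phiE _ nC) ?(phiE _ nA')
    ?(phiE _ nB') ?(phiE _ nC') /=; (try by apply: lr);
  first
    [ by apply: lk; rewrite /star /link /=; auto 10
    | by apply: (lk2 _ w); rewrite /star /link /=; auto 10
    | by apply: (lk2 _ A); rewrite /star /link /=; auto 10
    | by apply: (lk2 _ B); rewrite /star /link /=; auto 10
    | by apply: (lk2 _ C); rewrite /star /link /=; auto 10 ].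
Qed.

(** Unless all three edges are long, some spoke joins the hub to the rim. *)
Lemma star_rim (K : V -> V -> Prop) (A B C A' B' C' v : V) t :
  (long_count t < 3)%N ->
  exists2 h, h \in [:: A; B; C] & clos_refl_trans V (star K A B C A' B' C' v t) v h.
Proof.
move: t => [[[] []] []] //= _.
all: first [ by exists A; rewrite ?inE ?eqxx ?orbT //; apply: rt_step; rewrite /star /link /=; auto 10
 | by exists B; rewrite ?inE ?eqxx ?orbT //; apply: rt_step; rewrite /star /link /=; auto 10
 | by exists C; rewrite ?inE ?eqxx ?orbT //; apply: rt_step; rewrite /star /link /=; auto 10 ].
Qed.

(** Three long edges leave the hub without any edge; connectivity will exclude this
    configuration. *)
Lemma star_isolated (K : V -> V -> Prop) (A B C A' B' C' v u : V) :
  (forall u u', K u u' -> u <> v /\ u' <> v) ->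
  [/\ A' <> v, B' <> v & C' <> v] ->
  clos_refl_trans V (star K A B C A' B' C' v (true, true, true)) v u -> u = v.
Proof.
move=> Kv [nA nB nC] h.
suff H a b : clos_refl_trans V (star K A B C A' B' C' v (true, true, true)) a b ->
    a = v -> b = v by apply: H h _.
elim=> {a b} // [x y + E|x y z _ h1 _ h2 /h1 /h2 //].
by rewrite /star E /link /= => -[/Kv []|[[[]|[]]|[[[]|[]]|[[]|[]]]]] //; congruence.
Qed.

End Hexagon.

(** * Transfer of the connectivity condition between two graphs *)

Section Connected.
Variables (V : Type) (BS : set (set V)).

Definition separates (I : set V) (conn : V -> V -> Prop) : Prop :=
  (forall v, I v -> exists! S, BS S /\ S `<=` conn v) /\
  (forall S, BS S -> exists2 v, I v & S `<=` conn v).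

(** The boundary sets lie in [J] and every vertex is connected to a point of [J], so the condition
    depends only on which points of [J] are connected to each other. *)
Lemma separates_sub (I I' J : set V) (conn conn' : V -> V -> Prop) :
  (forall u v w, conn u v -> conn v w -> conn u w) ->
  (forall u v, conn u v -> conn v u) ->
  (forall u v w, conn' u v -> conn' v w -> conn' u w) ->
  (forall u v, conn' u v -> conn' v u) ->
  (forall S, BS S -> S `<=` J) -> J `<=` I -> J `<=` I' ->
  (forall u, I u -> exists2 h, J h & conn u h) ->
  (forall u, I' u -> exists2 h, J h & conn' u h) ->
  (forall u v, J u -> J v -> conn u v <-> conn' u v) ->
  separates I conn -> separates I' conn'.
Proof.
move=> tr sy tr' sy' BJ JI JI' toJ toJ' cc [s1 s2].
have eqS u h S : I' u -> J h -> conn' u h -> BS S -> (S `<=` conn' u) <-> (S `<=` conn h).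
  move=> Iu Jh uh bS; split=> sub x Sx.
    by apply/cc => //; [exact: BJ Sx|apply: tr' (sub x Sx); apply: sy'].
  by apply: tr' uh _; apply/cc => //; [exact: BJ Sx|exact: sub].
split.
  move=> u Iu; have [h Jh uh] := toJ' u Iu.
  have [S [[bS Sh] uS]] := s1 h (JI _ Jh).
  exists S; split; first by split=> //; apply/(eqS u h).
  by move=> S' [bS' Su]; apply: uS; split=> //; apply/(eqS u h).
move=> S bS; have [u Iu Su] := s2 S bS; have [h Jh uh] := toJ u Iu.
exists h; first exact: JI'.
move=> x Sx; apply/cc => //; first exact: BJ Sx.
by apply: tr (Su x Sx); apply: sy.
Qed.

End Connected.

(** * Configurations outside a hexagon, extended by choices on its three rhombi *)

Definition extend (x1 x2 x3 : rhomb) (o : set rhomb) (t : bool * bool * bool) : set rhomb :=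
  o `|` [set x | (x = x1 /\ t.1.1) \/ (x = x2 /\ t.1.2) \/ (x = x3 /\ t.2)].

(** The factor that one rhombus contributes to [weight]: the values at the ends of its chosen edge,
    and the edge variable if that edge is long. *)
Definition rhombus_weight (F : fieldType) (var : axis -> Z3 -> F) (f : Z3 -> F)
    (x : rhomb) (b : bool) : F :=
  if b then var x.1 x.2 * (f (long1 x) * f (long2 x)) else f x.2 * f (short2 x).

(** The adjacency outside the hexagon, which serves as the relation [K] of [star]. *)
Definition outer (R o : set rhomb) (u u' : Z3) : Prop :=
  exists2 x, R x & [set u; u'] = chosen o x.

Lemma linkE (a b u u' : Z3) : [set u; u'] = [set a; b] <-> link a b u u'.
Proof.
split; first exact: set2_eq.
by case=> -[-> ->] //; rewrite setUC.
Qed.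

Lemma linkC (V : choiceType) (a b : V) : link a b = link b a.
Proof. by apply/funext => u; apply/funext => u'; apply/propext; rewrite /link; tauto. Qed.

Section Extend.
Variables (R : set rhomb) (x1 x2 x3 : rhomb).
Hypotheses (nR1 : ~ R x1) (nR2 : ~ R x2) (nR3 : ~ R x3).
Hypotheses (n12 : x1 <> x2) (n13 : x1 <> x3) (n23 : x2 <> x3).
Let R3 := x1 |` (x2 |` (x3 |` R)).

Lemma extend_hub o t : o `<=` R ->
  [/\ extend x1 x2 x3 o t x1 <-> t.1.1, extend x1 x2 x3 o t x2 <-> t.1.2
    & extend x1 x2 x3 o t x3 <-> t.2].
Proof.
move=> oR; have no x : ~ R x -> ~ o x by move=> nR /oR.
have [n21 n31 n32] : [/\ x2 <> x1, x3 <> x1 & x3 <> x2] by split; move/esym.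
by split; split; rewrite /extend /=; first [ by move=> [/no|[[]|[[]|[]]]] // | by auto 6 ].
Qed.

Lemma extend_out o t x : R x -> extend x1 x2 x3 o t x <-> o x.
Proof.
move=> Rx; split; last by left.
by case=> // -[[E _]|[[E _]|[E _]]]; subst x.
Qed.

Lemma adjacent_extend L o t : o `<=` R -> rhombi L = R3 ->
  adjacent (graph_of L (extend x1 x2 x3 o t)) = fun u u' =>
    outer R o u u' \/
    (if t.1.1 then link (long1 x1) (long2 x1) u u' else link x1.2 (short2 x1) u u') \/
    (if t.1.2 then link (long1 x2) (long2 x2) u u' else link x2.2 (short2 x2) u u') \/
    (if t.2 then link (long1 x3) (long2 x3) u u' else link x3.2 (short2 x3) u u').
Proof.
move=> oR RL; have [h1 h2 h3] := extend_hub t oR.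
apply/funext => u; apply/funext => u'; apply/propext; rewrite /adjacent /graph_of /= RL.
have cE x (b : bool) : (extend x1 x2 x3 o t x <-> b) ->
    [set u; u'] = chosen (extend x1 x2 x3 o t) x <->
    (if b then link (long1 x) (long2 x) u u' else link x.2 (short2 x) u u').
  move=> h; rewrite /chosen linkE /end1 /end2 (asbool_equiv_eq h) asboolb.
  by case: (b).
have oE x : R x -> chosen o x = chosen (extend x1 x2 x3 o t) x.
  by move=> Rx; apply: eq_chosen; apply: iff_sym; apply: extend_out.
rewrite -(cE _ _ h1) -(cE _ _ h2) -(cE _ _ h3) /outer; split.
  case=> x [->|[->|[->|Rx]]] e; auto.
  by left; exists x; rewrite ?oE.
case=> [[x Rx e]|[e|[e|e]]].
- by exists x; [right; right; right|rewrite -oE].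
- by exists x1; [left|].
- by exists x2; [right; left|].
- by exists x3; [right; right; left|].
Qed.

Lemma extend_sub o t : o `<=` R -> extend x1 x2 x3 o t `<=` R3.
Proof.
move=> oR x [/oR Rx|]; first by right; right; right.
by rewrite /R3 /setU /=; move=> [[-> _]|[[-> _]|[-> _]]]; auto.
Qed.

Lemma extend_inj o t o' t' : o `<=` R -> o' `<=` R ->
  extend x1 x2 x3 o t = extend x1 x2 x3 o' t' -> o = o' /\ t = t'.
Proof.
move=> oR oR' E; split.
  apply/seteqP; split=> x ox.
    by have Rx := oR _ ox; move/(extend_out o t Rx): ox; rewrite E => /extend_out; apply.
  by have Rx := oR' _ ox; move/(extend_out o' t' Rx): ox; rewrite -E => /extend_out; apply.
have [h1 h2 h3] := extend_hub t oR; have := extend_hub t' oR'; rewrite -E => -[g1 g2 g3].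
have {g1 h1} e1 : t.1.1 = t'.1.1 by apply/idP/idP; [move/h1/g1|move/g1/h1].
have {g2 h2} e2 : t.1.2 = t'.1.2 by apply/idP/idP; [move/h2/g2|move/g2/h2].
have {g3 h3} e3 : t.2 = t'.2 by apply/idP/idP; [move/h3/g3|move/g3/h3].
by move: t t' e1 e2 e3 {E} => [[a b] c] [[a' b'] c'] /= -> -> ->.
Qed.

(** Together with [extend_inj], a configuration is the same as its outer part and three independent
    choices. *)
Lemma extend_surj S : S `<=` R3 ->
  S = extend x1 x2 x3 (S `&` R) (`[< S x1 >], `[< S x2 >], `[< S x3 >]).
Proof.
move=> SR; apply/seteqP; split=> x /=.
  move=> Sx; rewrite /extend /=; case: (SR _ Sx) => [E|[E|[E|Rx]]].
  - by right; left; rewrite -E; split=> //; apply/asboolP.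
  - by right; right; left; rewrite -E; split=> //; apply/asboolP.
  - by right; right; right; rewrite -E; split=> //; apply/asboolP.
  - by left.
by rewrite /extend /= => -[[]|[[-> /asboolP]|[[-> /asboolP]|[-> /asboolP]]]].
Qed.


Section ExtendWeight.
Variables (J : set Z3) (v : Z3) (o : set rhomb) (t : bool * bool * bool).
Hypotheses (oR : o `<=` R) (RJ : forall x, R x -> rhombus_at x.1 x.2 `<=` J) (nv : ~ J v).
Let S := extend x1 x2 x3 o t.

Let oS x : R x -> o x <-> S x.
Proof. by move=> Rx; apply: iff_sym; apply: extend_out. Qed.

Lemma finite_extend : finite_set o <-> finite_set S.
Proof.
split=> [fo|]; last by move=> fS; apply: sub_finite_set fS => x ox; left.
rewrite /S /extend finite_setU; split=> //.
apply: (@sub_finite_set _ _ [set x1; x2; x3]); last exact: finite_set3.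
by rewrite /setU /set1 /= => x [[-> _]|[[-> _]|[-> _]]]; rewrite /mkset; tauto.
Qed.

Lemma tame_extend : tame J R o <-> tame (v |` J) R3 S.
Proof.
have n2 : ~ (x3 |` R) x2 by case=> // /n23.
have n1 : ~ (x2 |` (x3 |` R)) x1 by case=> [/n12|[/n13|]].
(* On [R] the two configurations agree, so [S] may replace [o] before the hub and the three rhombi
   are adjoined one by one. *)
have -> : tame J R o <-> tame J R S.
  rewrite /tame finite_extend.
  suff -> : [set p | deg R o p <> 2%N] = [set p | deg R S p <> 2%N] by [].
  by apply/seteqP; split=> p /=; rewrite (eq_deg _ oS).
apply: iff_trans (tame_vertex _ _ _ v) _.
apply: iff_trans (tame_setU1 _ _ nR3) _.
apply: iff_trans (tame_setU1 _ _ n2) _.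
exact: tame_setU1.
Qed.

Variables (F : fieldType) (var : axis -> Z3 -> F) (f : Z3 -> F).

(** The hub is adjoined first, with degree 0 and hence exponent -2; each of the three rhombi then
    multiplies the weight by its own factor. *)
Lemma weight_extend :
  chosen S x1 `<=` v |` J -> chosen S x2 `<=` v |` J -> chosen S x3 `<=` v |` J ->
  (forall p, (v |` J) p -> f p != 0) -> tame J R o ->
  weight var f (v |` J) R3 S
    = f v ^ (-2) * rhombus_weight var f x1 t.1.1 * rhombus_weight var f x2 t.1.2 * rhombus_weight var f x3 t.2
        * weight var f J R o.
Proof.
move=> c1 c2 c3 f0 tJ.
have dv : deg R S v = 0%N.
  rewrite /deg; have -> : incident R S v = set0.
    by apply/seteqP; split=> // x [Rx /chosen_sub_rhombus /(RJ Rx)].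
  by rewrite fset_set0 cardfs0.
have tS : tame J R S.
  case: tJ => fo fI; split; first exact/finite_extend.
  by move: fI; congr (finite_set (_ `&` _)); apply/seteqP; split=> p /=; rewrite (eq_deg _ oS).
have tv : tame (v |` J) R S by exact: (proj1 (tame_vertex _ _ _ v)).
have n2 : ~ (x3 |` R) x2 by case=> // /n23.
have n1 : ~ (x2 |` (x3 |` R)) x1 by case=> [/n12|[/n13|]].
have t3 : tame (v |` J) (x3 |` R) S by exact: (proj1 (tame_setU1 _ _ nR3)).
have t2 : tame (v |` J) (x2 |` (x3 |` R)) S by exact: (proj1 (tame_setU1 _ _ n2)).
have V : vertex_weight f (v |` J) R3 S
    = (f (end1 S x1) * f (end2 S x1)) * (f (end1 S x2) * f (end2 S x2))
      * (f (end1 S x3) * f (end2 S x3)) * f v ^ (-2) * vertex_weight f J R o.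
  rewrite /R3 !vertex_weight_setU1 // vertex_weight_vertex //.
  rewrite /vertex_weight; under [X in _ = _ * X]eq_fsbigr do rewrite (eq_deg _ oS).
  by rewrite !mulrA.
have fo : finite_set o by case: tJ.
have [h1 h2 h3] := extend_hub t oR.
have no x : ~ R x -> ~ o x by move=> nR /oR.
have E : edge_weight var axis_a S * edge_weight var axis_b S * edge_weight var axis_c S
   = (if t.1.1 then var x1.1 x1.2 else 1) * (if t.1.2 then var x2.1 x2.2 else 1)
     * (if t.2 then var x3.1 x3.2 else 1)
     * (edge_weight var axis_a o * edge_weight var axis_b o * edge_weight var axis_c o).
  (* [S] is built from [o] by adjoining the long rhombi in turn, so that [edge_weights_setU1]
     applies to each. *)
  pose S3 := if t.2 then x3 |` o else o.
  pose S2 := if t.1.2 then x2 |` S3 else S3.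
  have eS : S = if t.1.1 then x1 |` S2 else S2.
    rewrite /S /S2 /S3 /extend; case: (t) => [[[] []] []] /=;
      by apply/seteqP; split=> x; rewrite /setU /=; intuition.
  have fS3 : finite_set S3 by rewrite /S3; case: ifP => // _; rewrite finite_setU.
  have fS2 : finite_set S2 by rewrite /S2; case: ifP => // _; rewrite finite_setU.
  have nS3 x : x <> x3 -> ~ o x -> ~ S3 x by rewrite /S3; case: ifP => // _ ? ? [].
  have nS2 : ~ S2 x1.
    by rewrite /S2; case: ifP => _; [case=> //|]; apply: nS3 => //; exact: no.
  rewrite eS.
  transitivity ((if t.1.1 then var x1.1 x1.2 else 1) *
     (edge_weight var axis_a S2 * edge_weight var axis_b S2 * edge_weight var axis_c S2)).
    by case: ifP => _; rewrite ?mul1r // edge_weights_setU1.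
  rewrite -!mulrA; congr (_ * _); rewrite !mulrA.
  transitivity ((if t.1.2 then var x2.1 x2.2 else 1) *
     (edge_weight var axis_a S3 * edge_weight var axis_b S3 * edge_weight var axis_c S3)).
    rewrite /S2; case: ifP => _; rewrite ?mul1r // edge_weights_setU1 //.
    by apply: nS3 => //; exact: no.
  rewrite -!mulrA; congr (_ * _); rewrite !mulrA /S3.
  by case: ifP => _; rewrite ?mul1r ?mulrA // edge_weights_setU1 ?mulrA //; exact: no.
have rw x (b : bool) : (S x <-> b) ->
    rhombus_weight var f x b = (if b then var x.1 x.2 else 1) * (f (end1 S x) * f (end2 S x)).
  move=> h; rewrite /rhombus_weight /end1 /end2 (asbool_equiv_eq h) asboolb.
  by case: b {h}; rewrite ?mul1r.
rewrite /weight E V !rw //; ring.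
Qed.

End ExtendWeight.

(** Groups the sum by outer configuration. A common finite index set [Os] lets the sums before and
    after an exchange be compared term by term. *)
Lemma sum_extend (F : fieldType) (Gr : set (set rhomb)) (Os : set (set rhomb))
    (W : set rhomb -> F) :
  (forall S, Gr S -> S `<=` R3) -> finite_set Os -> Os `<=` [set o | o `<=` R] ->
  (forall o t, o `<=` R -> Gr (extend x1 x2 x3 o t) -> Os o) ->
  \sum_(S \in Gr) W S =
  \sum_(o \in Os) \sum_(t \in [set: bool * bool * bool])
     (if `[< Gr (extend x1 x2 x3 o t) >] then W (extend x1 x2 x3 o t) else 0).
Proof.
move=> GR fO OR GO.
rewrite pair_fsbig //; last exact: finite_finset.
rewrite (@reindex_fsbig _ _ _ _ _ (fun p => extend x1 x2 x3 p.1 p.2)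
   [set p : set rhomb * (bool * bool * bool) | Os p.1 /\ Gr (extend x1 x2 x3 p.1 p.2)]).
  (* Pairs that do not extend to a member of [Gr] contribute zero and may be dropped. *)
  rewrite -[RHS](@fsbig_widen _ _ _ _
    [set p : set rhomb * (bool * bool * bool) | Os p.1 /\ Gr (extend x1 x2 x3 p.1 p.2)]).
  - by apply: eq_fsbigr => p; rewrite inE => -[_ g]; rewrite asboolT.
  - by move=> [o t] [].
  - by move=> [o t] [[/= Oo _] h] /=; rewrite asboolF // => g; apply: h.
split.
- by move=> [o t] [].
- move=> [o t] [o' t']; rewrite !inE => -[/= Oo _] [/= Oo' _] E.
  by have [-> ->] := extend_inj (OR _ Oo) (OR _ Oo') E.
- move=> S gS /=; have E := extend_surj (GR _ gS).
  exists (S `&` R, (`[< S x1 >], `[< S x2 >], `[< S x3 >])) => //=.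
  split; last by rewrite -E.
  by apply: (GO _ (`[< S x1 >], `[< S x2 >], `[< S x3 >])); [move=> ? []|rewrite -E].
Qed.

End Extend.

(** * Components, boundary sets and the exchange identity *)

Lemma conn_sym G u v : clos_refl_trans Z3 (adjacent G) u v -> clos_refl_trans Z3 (adjacent G) v u.
Proof.
elim=> {u v} [u v h|u|u v w _ h1 _ h2]; [|exact: rt_refl|exact: rt_trans h2 h1].
by apply: rt_step; rewrite /adjacent setUC.
Qed.

Lemma connected_withinE L N S :
  connected_within L N (graph_of L S) <->
  separates (boundary_set L N) (initial L) (clos_refl_trans Z3 (adjacent (graph_of L S))).
Proof. by []. Qed.

Definition boundary_point (N : int) : set Z3 :=
  [set p | let: (i, j, k) := p in
     [/\ i <= 0, j <= 0, k <= 0, i = 0 \/ j = 0 \/ k = 0 & i + j + k <= - N]].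

Lemma boundary_set_point L N S : 0 < N -> boundary_set L N S ->
  S `<=` boundary_point N /\ exists p, S p.
Proof.
move=> N0 [_ [[p [q [h1 h2 h3 [] ->]]]|[p h ->]|[q h [] ->]]];
  (split; last by eexists; rewrite /setU /set1 /=; eauto);
  move=> [[i j] k] /=; rewrite /setU /set1 /=;
  repeat match goal with |- _ \/ _ -> _ => case end; move=> [] -> -> ->; split; lia.
Qed.

Lemma max3_eq0 (i j k : int) : Num.max i (Num.max j k) = 0 <->
  [/\ i <= 0, j <= 0, k <= 0 & i = 0 \/ j = 0 \/ k = 0].
Proof.
pose P (x : int) := x = 0; change (P (Num.max i (Num.max j k)) <->
  [/\ i <= 0, j <= 0, k <= 0 & i = 0 \/ j = 0 \/ k = 0]).
rewrite /Order.max; case: (ltP j k) => h2; case: ltP => h1;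
  rewrite /P; split=> [h|[]]; first [by split; lia | by move: h1 h2; lia].
Qed.

Lemma max3_lt0 (i j k : int) : Num.max i (Num.max j k) < 0 <-> [/\ i < 0, j < 0 & k < 0].
Proof.
pose P (x : int) := x < 0; change (P (Num.max i (Num.max j k)) <-> [/\ i < 0, j < 0 & k < 0]).
rewrite /Order.max; case: (ltP j k) => h2; case: ltP => h1;
  rewrite /P; split=> [h|[]]; first [by split; lia | by move: h1 h2; lia].
Qed.

Lemma boundary_point_initial L N : cutoff L N -> boundary_point N `<=` initial L.
Proof. by move=> [c _] [[i j] k] [h1 h2 h3 h4 h5]; apply: c => //; apply/max3_eq0. Qed.

(** Only containment in the initial set mentions the ideal. For positive [N] the listed points
    satisfy condition (i) of a cutoff, so this containment is automatic. *)
Lemma boundary_set_eq L L' N : 0 < N -> cutoff L N -> cutoff L' N ->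
  boundary_set L N = boundary_set L' N.
Proof.
suff H K K' : 0 < N -> cutoff K' N -> boundary_set K N `<=` boundary_set K' N.
  by move=> N0 c c'; apply/seteqP; split; apply: H.
move=> N0 c S bS; split; last by case: bS.
by apply: subset_trans (boundary_point_initial c); apply: (proj1 (boundary_set_point N0 bS)).
Qed.

(** The coefficients mark the matching classes: [g0] for [v] of degree 3 and [w] of degree 1, [g4]
    for the reverse, and [g1], [g2], [g3] for degree 2 on both sides. The terms of degree 2 agree
    one by one; the recurrence equates one term with three in the other two classes. *)
Lemma star_exchange (F : fieldType) (v w a b c A B C A' B' C' W g0 g1 g2 g3 g4 : F) :
  v != 0 -> w != 0 ->
  v * w = b * c * A * A' + c * a * B * B' + a * b * C * C' ->
  g0 * (v ^ (-2) * (A * v) * (B * v) * (C * v) * W)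
  + (g1 * (v ^ (-2) * (a * (C' * B')) * (B * v) * (C * v) * W)
     + g2 * (v ^ (-2) * (A * v) * (b * (C' * A')) * (C * v) * W)
     + g3 * (v ^ (-2) * (A * v) * (B * v) * (c * (B' * A')) * W))
  + (g4 * (v ^ (-2) * (a * (C' * B')) * (b * (C' * A')) * (C * v) * W)
     + g4 * (v ^ (-2) * (a * (C' * B')) * (B * v) * (c * (B' * A')) * W)
     + g4 * (v ^ (-2) * (A * v) * (b * (C' * A')) * (c * (B' * A')) * W))
  = g4 * (w ^ (-2) * (w * A') * (w * B') * (w * C') * W)
  + (g1 * (w ^ (-2) * (a * (B * C)) * (w * B') * (w * C') * W)
     + g2 * (w ^ (-2) * (w * A') * (b * (A * C)) * (w * C') * W)
     + g3 * (w ^ (-2) * (w * A') * (w * B') * (c * (A * B)) * W))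
  + (g0 * (w ^ (-2) * (a * (B * C)) * (b * (A * C)) * (w * C') * W)
     + g0 * (w ^ (-2) * (a * (B * C)) * (w * B') * (c * (A * B)) * W)
     + g0 * (w ^ (-2) * (w * A') * (b * (A * C)) * (c * (A * B)) * W)).
Proof.
move=> v0 w0 e; rewrite (_ : v ^ (-2) = (v * v)^-1) // (_ : w ^ (-2) = (w * w)^-1) //.
set n := _ + _ in e.
have n0 : n != 0 by rewrite -e mulf_neq0.
(* Eliminating [v] leaves an identity with no relation among the remaining elements. *)
have -> : v = n / w by rewrite -e mulfK.
rewrite /n; field; rewrite ?w0 //; exact: n0.
Qed.

(** * Adding a point to the order ideal *)

Section Step.
Variables (L : set Z3) (N i j k : int).
Hypotheses (hL : order_ideal L) (cL : cutoff L N).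
Hypotheses (C0 : cone (0, 0, 0) (i, j, k)) (Uw : ~ L (i, j, k)).
Hypothesis below : forall q, cone (i, j, k) q -> q <> (i, j, k) -> L q.

Let w : Z3 := (i, j, k).
Let v : Z3 := (i - 1, j - 1, k - 1).
Let L' := w |` L.
(** [J] is the common part of the two initial sets, and [R] consists of the rhombi common to both
    tilings. *)
Let J := initial L `\ v.
Let R : set rhomb := [set x | rhombus_at x.1 x.2 `<=` J].


Lemma initial_v : initial L v.
Proof.
split; first by apply: below; [split; lia|move=> []; lia].
by rewrite /v !subrK.
Qed.

Lemma initialE : initial L = v |` J.
Proof.
apply/seteqP; split=> p; first by case: (pselect (p = v)) => [->|]; [left|right].
by case=> [->|[]//]; exact: initial_v.
Qed.

(** Adjoining [w] to the ideal disqualifies only the point whose shift is [w], namely [v]. The shift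
    of [w] stays outside, since otherwise [w] would already be in [L]. *)
Lemma initialE' : initial L' = w |` J.
Proof.
have nw : w <> v by move=> []; lia.
apply/seteqP; split.
  move=> [[a b] c] [[E|Lp] Up]; first by left.
  right; split; last by move=> E; apply: Up; left; move: E => [-> -> ->]; rewrite !subrK.
  by split=> // Lp'; apply: Up; right.
move=> [[a b] c] [E|[[Lp Up] nv]].
  split; first by left.
  move: E => [-> -> ->] [[]|]; first by lia.
  by move=> /hL h; apply: Uw; apply: h; split; lia.
split; first by right.
move=> [[Ea Eb Ec]|//]; apply: nv; rewrite /v -Ea -Eb -Ec /=.
by congr (_, _, _); lia.
Qed.

Lemma not_J_w : ~ J w. Proof. by case=> -[]. Qed.
Lemma not_J_v : ~ J v. Proof. by case=> _; apply. Qed.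

(** A point of the unit cube other than [v] and [w] is strictly below [w], hence in [L], while its
    shift by (1,1,1) is above [w], hence not in [L]. *)
Lemma rim_J q : cone w q -> cone q v -> q <> v -> q <> w -> J q.
Proof.
move: q => [[a b] c] [h1 h2 h3] [g1 g2 g3] nv nw; split=> //; split.
  by apply: below.
by move=> /hL h; apply: Uw; apply: h; split; lia.
Qed.

Lemma order_ideal' : order_ideal L'.
Proof.
move=> p [->|Lp] q cq; last by right; apply: hL cq.
by case: (pselect (q = w)) => [->|nq]; [left|right; apply: below].
Qed.

(** Otherwise condition (i) would put the origin, and with it [w], into [L]. *)
Lemma N_gt0 : 0 < N.
Proof.
rewrite ltNge; apply/negP => N0.
have [L0 _] : initial L (0, 0, 0) by apply: (proj1 cL); [lia|apply/max3_eq0; split; auto].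
by apply: Uw; apply: (hL L0).
Qed.

(** All coordinates of the initial point [v] are negative, so condition (ii) bounds its coordinate
    sum, which is three less than that of [w]. *)
Lemma w_sum : - N < i + j + k.
Proof.
rewrite ltNge; apply/negP => h; apply: (proj2 cL (i - 1) (j - 1) (k - 1)).
- lia.
- by apply/max3_lt0; move: C0 => [] ? ? ?; split; lia.
- exact: initial_v.
Qed.

(** The lost point [v] has negative maximum, so (i) does not concern it; the new point [w] has too
    large a sum for (ii). *)
Lemma cutoff' : cutoff L' N.
Proof.
have [c1 c2] := cL; have ws := w_sum; have [i0 j0 k0] := C0; split=> a b c h m.
  have : initial L (a, b, c) by apply: c1.
  rewrite initialE initialE' => -[[Ea Eb Ec]|]; last by right.
  by move/max3_eq0: m => []; lia.
rewrite initialE' => -[[Ea Eb Ec]|Jp]; first by lia.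
by apply: (c2 a b c) => //; rewrite initialE; right.
Qed.

Let la : rhomb := (axis_a, (i - 1, j, k)).
Let lb : rhomb := (axis_b, (i, j - 1, k)).
Let lc : rhomb := (axis_c, (i, j, k - 1)).
Let ua : rhomb := (axis_a, (i, j, k)).
Let ub : rhomb := (axis_b, (i, j, k)).
Let uc : rhomb := (axis_c, (i, j, k)).

Ltac rim := apply: rim_J; [by split; lia|by split; lia|by case; lia|by case; lia].

(** A corner strictly below [v] would have its shift by (1,1,1) strictly below [w], hence in [L]. So
    [v] can only be the lowest corner of a rhombus. *)
Lemma rhombi_low : rhombi L = la |` (lb |` (lc |` R)).
Proof.
apply/seteqP; split.
  move=> x Rx.
  case: (pselect (rhombus_at x.1 x.2 v)) => [vx|nvx]; last first.
    right; right; right; move=> p px; split; first exact: Rx.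
    by move=> E; apply: nvx; rewrite -E.
  have noL q : initial L q -> cone w (q.1.1 + 1, q.1.2 + 1, q.2 + 1) ->
      (q.1.1 + 1, q.1.2 + 1, q.2 + 1) <> w -> False.
    by move: q => [[a b] c] [_ Uq] h1 h2; apply: Uq; apply: below.
  case: x Rx vx => [[] [[a b] c]] Rx /=; rewrite /setU /set1 /= => vx.
  - have h1 : initial L (a, b - 1, c) by apply: Rx; rewrite /= /setU /set1 /=; auto.
    have h2 : initial L (a, b, c - 1) by apply: Rx; rewrite /= /setU /set1 /=; auto.
    have h3 : initial L (a, b - 1, c - 1) by apply: Rx; rewrite /= /setU /set1 /=; auto.
    case: vx => [[[]|]|] [] Ea Eb Ec.
    + by case: (noL _ h1); [split; rewrite /=; lia|case; lia].
    + by case: (noL _ h3); [split; rewrite /=; lia|case; lia].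
    + by case: (noL _ h3); [split; rewrite /=; lia|case; lia].
    + by left; congr (_, (_, _, _)); lia.
  - have h1 : initial L (a - 1, b, c) by apply: Rx; rewrite /= /setU /set1 /=; auto.
    have h2 : initial L (a, b, c - 1) by apply: Rx; rewrite /= /setU /set1 /=; auto.
    have h3 : initial L (a - 1, b, c - 1) by apply: Rx; rewrite /= /setU /set1 /=; auto.
    case: vx => [[[]|]|] [] Ea Eb Ec.
    + by case: (noL _ h1); [split; rewrite /=; lia|case; lia].
    + by case: (noL _ h3); [split; rewrite /=; lia|case; lia].
    + by case: (noL _ h3); [split; rewrite /=; lia|case; lia].
    + by right; left; congr (_, (_, _, _)); lia.
  - have h1 : initial L (a - 1, b, c) by apply: Rx; rewrite /= /setU /set1 /=; auto.
    have h2 : initial L (a, b - 1, c) by apply: Rx; rewrite /= /setU /set1 /=; auto.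
    have h3 : initial L (a - 1, b - 1, c) by apply: Rx; rewrite /= /setU /set1 /=; auto.
    case: vx => [[[]|]|] [] Ea Eb Ec.
    + by case: (noL _ h1); [split; rewrite /=; lia|case; lia].
    + by case: (noL _ h3); [split; rewrite /=; lia|case; lia].
    + by case: (noL _ h3); [split; rewrite /=; lia|case; lia].
    + by right; right; left; congr (_, (_, _, _)); lia.
move=> x [->|[->|[->|Rx]]] q /=; rewrite initialE; last by move=> /Rx; right.
all: rewrite /setU /set1 /= => -[[[]|]|] ->; first [left; congr (_, _, _); lia | right; rim].
Qed.

(** Dually, [w] can only be the highest corner: a point of [L] above [w] would put [w] into [L]. *)
Lemma rhombi_up : rhombi L' = ua |` (ub |` (uc |` R)).
Proof.
apply/seteqP; split.
  move=> x Rx.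
  case: (pselect (rhombus_at x.1 x.2 w)) => [wx|nwx]; last first.
    right; right; right; move=> p px.
    have : initial L' p by apply: Rx.
    by rewrite initialE' => -[E|//]; case: nwx; rewrite -E.
  have noL : initial L' x.2 -> cone x.2 w -> x.2 = w.
    rewrite initialE' => -[//|[[Lx _] _]] h; case: Uw; exact: hL h.
  have {}noL : cone x.2 w -> x.2 = w.
    apply: noL; apply: Rx; case: (x) => [[] [[a b] c]]; rewrite /= /setU /set1 /=; auto.
  have E : x.2 = w.
    apply: noL; case: x wx {Rx} => [[] [[a b] c]] /=;
      rewrite /setU /set1 /= => -[[[]|]|] [] ? ? ?; split; lia.
  by case: x E {Rx wx noL} => [[] p] /= ->; [left|right; left|right; right; left].
move=> x [->|[->|[->|Rx]]] q /=; rewrite initialE'; last by move=> /Rx; right.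
all: rewrite /setU /set1 /= => -[[[]|]|] ->; first [left; congr (_, _, _); lia | right; rim].
Qed.

Lemma not_R_low : [/\ ~ R la, ~ R lb & ~ R lc].
Proof.
by split=> Rx; apply: not_J_v; apply: Rx; rewrite /= /setU /set1 /=; auto.
Qed.

Lemma not_R_up : [/\ ~ R ua, ~ R ub & ~ R uc].
Proof.
by split=> Rx; apply: not_J_w; apply: Rx; rewrite /= /setU /set1 /=; auto.
Qed.

Definition low := extend la lb lc.
Definition up := extend ua ub uc.

(** The rim of the hexagon: the unprimed points are one step below [w], the primed ones one step
    above [v], and [A], [A'] are opposite, as are the other two pairs. *)
Let A : Z3 := (i - 1, j, k).
Let B : Z3 := (i, j - 1, k).
Let C : Z3 := (i, j, k - 1).
Let A' : Z3 := (i, j - 1, k - 1).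
Let B' : Z3 := (i - 1, j, k - 1).
Let C' : Z3 := (i - 1, j - 1, k).

Let lab : la <> lb. Proof. by []. Qed.
Let lac : la <> lc. Proof. by []. Qed.
Let lbc : lb <> lc. Proof. by []. Qed.
Let uab : ua <> ub. Proof. by []. Qed.
Let uac : ua <> uc. Proof. by []. Qed.
Let ubc : ub <> uc. Proof. by []. Qed.

Lemma adjacent_low o t : o `<=` R ->
  adjacent (graph_of L (low o t)) = star (outer R o) A B C A' B' C' v t.
Proof.
move=> oR; have [n1 n2 n3] := not_R_low.
rewrite /low (adjacent_extend n1 n2 n3 lab lac lbc t oR rhombi_low).
by rewrite /star (linkC B' C') (linkC A' C') (linkC A' B').
Qed.

Lemma adjacent_up o t : o `<=` R ->
  adjacent (graph_of L' (up o t)) = star (outer R o) A' B' C' A B C w t.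
Proof.
move=> oR; have [n1 n2 n3] := not_R_up.
rewrite /up (adjacent_extend n1 n2 n3 uab uac ubc t oR rhombi_up).
by rewrite /star (linkC A' w) (linkC B' w) (linkC C' w).
Qed.

Lemma outer_J o u u' : outer R o u u' -> J u /\ J u'.
Proof.
case=> x Rx e; split; apply: (Rx); apply: (@chosen_sub_rhombus o); rewrite -e; [by left|by right].
Qed.

Lemma rims : [/\ J A, J B & J C] /\ [/\ J A', J B' & J C'].
Proof. by split; split; rim. Qed.

Let nJ (q p : Z3) : J q -> ~ J p -> q <> p.
Proof. by move=> Jq np E; apply: np; rewrite -E. Qed.

Lemma conn_low_up o t s u u' : o `<=` R -> matching t s -> J u -> J u' ->
  clos_refl_trans Z3 (adjacent (graph_of L (low o t))) u u' <->
  clos_refl_trans Z3 (adjacent (graph_of L' (up o s))) u u'.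
Proof.
move=> oR ts Ju Ju'; rewrite adjacent_low // adjacent_up //.
have [[JA JB JC] [JA' JB' JC']] := rims.
have nv := not_J_v; have nw := not_J_w.
split; apply: star_sub; rewrite // ?[matching s t]matching_sym //;
  try by [split; exact: nJ | exact: nJ];
  by move=> a b /outer_J [Ja Jb]; split; exact: nJ.
Qed.

(** Compactness does not constrain the hexagon: the highest corner of each of its rhombi has sum one
    less than that of [w], which is at least [- N]. *)
Lemma compact_low o t : o `<=` R ->
  conf_compact N (rhombi L) (low o t) <-> conf_compact N R o.
Proof.
move=> oR; have [n1 n2 n3] := not_R_low; have ws := w_sum.
split=> h x Rx c.
  move=> ox; apply: (h x) => //; last by left.
  by rewrite rhombi_low; right; right; right.
case=> [ox|]; first exact: (h x (oR _ ox)).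
case=> [[E _]|[[E _]|[E _]]]; subst x.
- have c' := c (i - 1) j k; suff : (i - 1) + j + k < - N by lia.
  by apply: c'; rewrite /= /setU /set1 /=; auto.
- have c' := c i (j - 1) k; suff : i + (j - 1) + k < - N by lia.
  by apply: c'; rewrite /= /setU /set1 /=; auto.
- have c' := c i j (k - 1); suff : i + j + (k - 1) < - N by lia.
  by apply: c'; rewrite /= /setU /set1 /=; auto.
Qed.

Lemma compact_up o t : o `<=` R ->
  conf_compact N (rhombi L') (up o t) <-> conf_compact N R o.
Proof.
move=> oR; have [n1 n2 n3] := not_R_up; have ws := w_sum.
split=> h x Rx c.
  move=> ox; apply: (h x) => //; last by left.
  by rewrite rhombi_up; right; right; right.
case=> [ox|]; first exact: (h x (oR _ ox)).
have cw : ~ rhombus_at x.1 x.2 w by move=> /c; lia.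
by case=> [[E _]|[[E _]|[E _]]]; subst x; apply: cw; rewrite /= /setU /set1 /=; auto.
Qed.

Let BS := boundary_set L N.
Let BS' : boundary_set L' N = BS.
Proof. by apply: boundary_set_eq; [exact: N_gt0|exact: cutoff'|]. Qed.

(** Since [N] is a cutoff for both ideals, boundary points lie in both initial sets, which meet
    exactly in [J]. *)
Lemma boundary_J S : BS S -> S `<=` J /\ exists p, S p.
Proof.
move=> bS; have [h1 h2] := boundary_set_point N_gt0 bS; split=> //.
move=> p /h1 bp; have := boundary_point_initial cutoff' bp.
have := boundary_point_initial cL bp.
rewrite initialE' initialE => -[->|//] [E|//].
by case: E; lia.
Qed.

(** The hub would be a component by itself, but each component must contain a nonempty boundary set
    inside [J]. *)
Lemma isolated_low o : o `<=` R -> ~ grove_conf L N (low o (true, true, true)).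
Proof.
move=> oR [_ _ [h _]].
have [S [[/boundary_J [SJ [p Sp]] Sv] _]] := h v initial_v.
have := Sv p Sp; rewrite /component /mkset adjacent_low // => /star_isolated E.
apply: not_J_v; rewrite -{1}E; first exact: SJ.
  by move=> a b /outer_J [Ja Jb]; split; apply: nJ => //; exact: not_J_v.
by have [_ [JA' JB' JC']] := rims; split; apply: nJ => //; exact: not_J_v.
Qed.

Lemma isolated_up o : o `<=` R -> ~ grove_conf L' N (up o (true, true, true)).
Proof.
move=> oR [_ _ [h _]].
have Iw : initial L' w by rewrite initialE'; left.
have [S [[]]] := h w Iw; rewrite BS' => /boundary_J [SJ [p Sp]] Sv _.
have := Sv p Sp; rewrite /component /mkset adjacent_up // => /star_isolated E.
apply: not_J_w; rewrite -{1}E; first exact: SJ.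
  by move=> a b /outer_J [Ja Jb]; split; apply: nJ => //; exact: not_J_w.
by have [[JA JB JC] _] := rims; split; apply: nJ => //; exact: not_J_w.
Qed.

Lemma matching_lt3 t s : matching t s -> (long_count t < 3)%N.
Proof. by move: t s => [[[] []] []] [[[] []] []]. Qed.

(** Compactness depends only on [o]. Connectivity transfers by [separates_sub], because [star_rim]
    connects either hub to [J] and connections inside [J] agree. *)
Lemma grove_low_up o t s : o `<=` R -> matching t s ->
  grove_conf L N (low o t) <-> grove_conf L' N (up o s).
Proof.
move=> oR ts; have [[JA JB JC] [JA' JB' JC']] := rims.
have toJ u : initial L u ->
    exists2 h, J h & clos_refl_trans Z3 (adjacent (graph_of L (low o t))) u h.
  rewrite initialE => -[->|Ju]; last by exists u => //; exact: rt_refl.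
  rewrite adjacent_low //.
  have [h hm c] := star_rim (outer R o) A B C A' B' C' v (matching_lt3 ts).
  by exists h => //; move: hm; rewrite !inE => /or3P [] /eqP ->.
have toJ' u : initial L' u ->
    exists2 h, J h & clos_refl_trans Z3 (adjacent (graph_of L' (up o s))) u h.
  rewrite initialE' => -[->|Ju]; last by exists u => //; exact: rt_refl.
  rewrite adjacent_up //; move: ts; rewrite matching_sym => /matching_lt3 s3.
  have [h hm c] := star_rim (outer R o) A' B' C' A B C w s3.
  by exists h => //; move: hm; rewrite !inE => /or3P [] /eqP ->.
have tr G (u u' u'' : Z3) : clos_refl_trans Z3 (adjacent G) u u' ->
    clos_refl_trans Z3 (adjacent G) u' u'' -> clos_refl_trans Z3 (adjacent G) u u''.
  exact: rt_trans.
have sy G (u u' : Z3) := @conn_sym G u u'.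
have JI : J `<=` initial L by rewrite initialE; right.
have JI' : J `<=` initial L' by rewrite initialE'; right.
have BJ S : BS S -> S `<=` J by move/boundary_J => [].
split=> -[_ cp /connected_withinE cn]; split.
- by rewrite rhombi_up; exact: extend_sub.
- by apply/(compact_up s oR)/(compact_low t oR).
- apply/connected_withinE; rewrite BS'.
  apply: (separates_sub (tr _) (sy _) (tr _) (sy _) BJ JI JI' toJ toJ' _ cn).
  by move=> a b Ja Jb; exact: conn_low_up.
- by rewrite rhombi_low; exact: extend_sub.
- by apply/(compact_low t oR)/(compact_up s oR).
- apply/connected_withinE; move: cn; rewrite BS' => cn.
  apply: (separates_sub (tr _) (sy _) (tr _) (sy _) BJ JI' JI toJ' toJ _ cn).
  by move=> a b Ja Jb; apply: iff_sym; exact: conn_low_up.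
Qed.

Section Sum.
Variables (F : fieldType) (var : axis -> Z3 -> F) (f : Z3 -> F).
(** Opposite rhombi of the hexagon carry the same edge variable, since the variable ignores the
    coordinate normal to the rhombus. *)
Hypotheses (va : var axis_a A = var axis_a w) (vb : var axis_b B = var axis_b w)
  (vc : var axis_c C = var axis_c w).
Hypothesis recurrence : f w * f v = var axis_b w * var axis_c w * f A * f A'
  + var axis_c w * var axis_a w * f B * f B' + var axis_a w * var axis_b w * f C * f C'.
Hypotheses (f0 : forall p, initial L p -> f p != 0) (fw0 : f w != 0).

Let weight_low o t : o `<=` R -> tame J R o ->
  weight var f (initial L) (rhombi L) (low o t)
  = f v ^ (-2) * rhombus_weight var f la t.1.1 * rhombus_weight var f lb t.1.2
      * rhombus_weight var f lc t.2 * weight var f J R o.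
Proof.
move=> oR tJ; have [n1 n2 n3] := not_R_low; rewrite rhombi_low.
have c x : rhombi L x -> chosen (extend la lb lc o t) x `<=` v |` J.
  by move=> Rx p /chosen_sub_rhombus /Rx; rewrite initialE.
rewrite /low initialE; apply: (weight_extend n1 n2 n3 lab lac lbc) => //.
- exact: not_J_v.
- by apply: c; rewrite rhombi_low; left.
- by apply: c; rewrite rhombi_low; right; left.
- by apply: c; rewrite rhombi_low; right; right; left.
- by move=> p; rewrite -initialE; exact: f0.
Qed.

Let weight_up o t : o `<=` R -> tame J R o ->
  weight var f (initial L') (rhombi L') (up o t)
  = f w ^ (-2) * rhombus_weight var f ua t.1.1 * rhombus_weight var f ub t.1.2
      * rhombus_weight var f uc t.2 * weight var f J R o.
Proof.
move=> oR tJ; have [n1 n2 n3] := not_R_up; rewrite rhombi_up.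
have c x : rhombi L' x -> chosen (extend ua ub uc o t) x `<=` w |` J.
  by move=> Rx p /chosen_sub_rhombus /Rx; rewrite initialE'.
rewrite /up initialE'; apply: (weight_extend n1 n2 n3 uab uac ubc) => //.
- exact: not_J_w.
- by apply: c; rewrite rhombi_up; left.
- by apply: c; rewrite rhombi_up; right; left.
- by apply: c; rewrite rhombi_up; right; right; left.
- by move=> p [->|[Ip _]] //; exact: f0.
Qed.

Lemma sum_bool3 (g : bool * bool * bool -> F) :
  \sum_(t \in [set: bool * bool * bool]) g t
  = g (false, false, false) + (g (true, false, false) + g (false, true, false)
    + g (false, false, true)) + (g (true, true, false) + g (true, false, true)
    + g (false, true, true)) + g (true, true, true).
Proof.
rewrite (@fsbigE _ _ _ _ _ [:: (false, false, false); (true, false, false);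
  (false, true, false); (false, false, true); (true, true, false); (true, false, true);
  (false, true, true); (true, true, true)]) //; last by move=> [[[] []] []].
rewrite (eq_bigl xpredT) => [|t]; last by rewrite in_setT.
rewrite !big_cons big_nil /=; ring.
Qed.

(** Of the eight choices on each side, the one with three long edges never gives a grove; the other
    seven fall into five matching classes, each valid on both sides or on neither. *)
Lemma local_sum o : o `<=` R -> tame J R o ->
  \sum_(t \in [set: bool * bool * bool])
     (if `[< grove_conf L N (low o t) >]
      then weight var f (initial L) (rhombi L) (low o t) else 0)
  = \sum_(t \in [set: bool * bool * bool])
     (if `[< grove_conf L' N (up o t) >]
      then weight var f (initial L') (rhombi L') (up o t) else 0).
Proof.
move=> oR tJ.
have fv0 : f v != 0 by apply: f0; exact: initial_v.
rewrite !sum_bool3 !weight_low // !weight_up //.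
have m t s : matching t s -> `[< grove_conf L' N (up o s) >] = `[< grove_conf L N (low o t) >].
  by move=> ts; apply: asbool_equiv_eq; apply: iff_sym; exact: grove_low_up.
rewrite (asboolF (isolated_low oR)) (asboolF (isolated_up oR)).
(* All indicators are reduced to one representative per matching class. *)
rewrite (m (true, true, false) (false, false, false)) // (m (false, false, false) (true, true, false)) //.
rewrite (m (false, false, false) (true, false, true)) // (m (false, false, false) (false, true, true)) //.
rewrite (m (true, false, false) (true, false, false)) // (m (false, true, false) (false, true, false)) //.
rewrite (m (false, false, true) (false, false, true)) //.
rewrite -(m (true, false, true) (false, false, false)) // -(m (false, true, true) (false, false, false)) //.
rewrite (m (true, true, false) (false, false, false)) //.
have b (c : bool) (y : F) : (if c then y else 0) = c%:R * y by case: c; rewrite ?mul1r ?mul0r.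
rewrite !b /rhombus_weight /= -/A -/B -/C -/A' -/B' -/C' -/v -/w va vb vc !addr0.
by apply: star_exchange => //; rewrite mulrC; exact: recurrence.
Qed.

(** The induction runs from the larger ideal back to [L]: finiteness and tameness pass through the
    outer configurations, which the groves of both sides share. *)
Lemma grove_step :
  finite_set [set S | grove_conf L' N S] ->
  (forall S, grove_conf L' N S -> tame (initial L') (rhombi L') S) ->
  [/\ finite_set [set S | grove_conf L N S],
      forall S, grove_conf L N S -> tame (initial L) (rhombi L) S
    & \sum_(S \in [set S | grove_conf L N S]) weight var f (initial L) (rhombi L) S
      = \sum_(S \in [set S | grove_conf L' N S]) weight var f (initial L') (rhombi L') S].
Proof.
move=> fG tG.
have [n1 n2 n3] := not_R_low; have [m1 m2 m3] := not_R_up.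
pose Os := [set o | o `<=` R /\ exists s, grove_conf L' N (up o s)].
have GO' o s : o `<=` R -> grove_conf L' N (up o s) -> Os o by move=> oR g; split=> //; exists s.
have GO o t : o `<=` R -> grove_conf L N (low o t) -> Os o.
  move=> oR g; case: (eqVneq t (true, true, true)) => [E|nt].
    by case: (isolated_low oR); rewrite -E.
  (* Every choice with at least one short edge has a partner on the other side. *)
  have [s ts] : exists s, matching t s.
    by move: t nt {g} => [[[] []] []] // _;
      first [by exists (true, true, false) | by exists (false, false, false)
        | by exists (true, false, false) | by exists (false, true, false)
        | by exists (false, false, true)].
  by apply: (GO' _ s) => //; apply/(grove_low_up oR ts).
have OR : Os `<=` [set o | o `<=` R] by move=> o [].
have upR o s : o `<=` R -> up o s `&` R = o.
  move=> oR; apply/seteqP; split=> x; first by move=> [h Rx]; apply/(extend_out m1 m2 m3 o s Rx).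
  by move=> ox; split; [left|apply: oR].
(* The outer part is recovered by intersecting with [R], so [Os] lies in the image of a finite
   set. *)
have fO : finite_set Os.
  apply: (sub_finite_set _ (finite_image (fun S => S `&` R) fG)) => o [oR [s g]].
  by exists (up o s) => //; exact: upR.
have tO o : Os o -> tame J R o.
  move=> [oR [s g]]; have := tG _ g; rewrite initialE' rhombi_up.
  by move/(tame_extend m1 m2 m3 uab uac ubc).
have RL S : grove_conf L N S -> exists o t, [/\ o `<=` R, S = low o t & Os o].
  move=> g; case: (g) => SR _ _; move: SR; rewrite rhombi_low => /extend_surj E.
  exists (S `&` R), (`[< S la >], `[< S lb >], `[< S lc >]); split; [by move=> ? []|by []|].
  by apply: (GO _ (`[< S la >], `[< S lb >], `[< S lc >])); [move=> ? []|rewrite /low -E].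
split.
- have fX : finite_set (Os `*` [set: bool * bool * bool]).
    by apply: finite_setX => //; exact: finite_finset.
  apply: (sub_finite_set _ (finite_image (fun p => low p.1 p.2) fX)) => S /RL [o [t [oR -> Oo]]].
  by exists (o, t).
- move=> S /RL [o [t [oR -> /tO tJ]]]; rewrite initialE rhombi_low.
  exact: (proj1 (tame_extend n1 n2 n3 lab lac lbc J v o t)).
rewrite (sum_extend n1 n2 n3 lab lac lbc (Os := Os)) //; last first.
  by move=> S [SR _ _]; rewrite -rhombi_low.
rewrite (sum_extend m1 m2 m3 uab uac ubc (Os := Os)) //; last first.
  by move=> S [SR _ _]; rewrite -rhombi_up.
apply: eq_fsbigr => o; rewrite inE => Oo; apply: local_sum; first by case: Oo.
exact: tO.
Qed.

End Sum.
End Step.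

(** * The full octant *)

Lemma Z3E (i j k i' j' k' : int) : ((i, j, k) = (i', j', k')) = (i = i' /\ j = j' /\ k = k').
Proof. by apply/propext; split=> [[-> -> ->]|[-> [-> ->]]]. Qed.

Definition octant : set Z3 := cone (0, 0, 0).

Lemma initial_octant (i j k : int) : initial octant (i, j, k) <->
  [/\ i <= 0, j <= 0, k <= 0 & i = 0 \/ j = 0 \/ k = 0].
Proof.
rewrite /initial /octant /upper /=; split.
  move=> [[h1 h2 h3] h]; split=> //; apply: contrapT => n; apply: h; split; lia.
by move=> [h1 h2 h3 h4]; split=> // -[]; lia.
Qed.

Definition octant_rhombus (x : rhomb) : Prop :=
  let: (d, (i, j, k)) := x in
  match d with
  | axis_a => [/\ i = 0, j <= 0 & k <= 0]
  | axis_b => [/\ i <= 0, j = 0 & k <= 0]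
  | axis_c => [/\ i <= 0, j <= 0 & k = 0]
  end.

(** The far end of the short edge has two negative coordinates, so the third one must vanish: the
    rhombi tile three coordinate quadrants. *)
Lemma rhombi_octant x : rhombi octant x <-> octant_rhombus x.
Proof.
split; last first.
  by case: x => [[] [[i j] k]] [h1 h2 h3] [[i' j'] k']; rewrite /= /setU /set1 /= !Z3E
    => e; apply/initial_octant; split; lia.
case: x => [[] [[i j] k]] Rx.
- have : initial octant (i, j, k) by apply: Rx; rewrite /= /setU /set1 /=; auto.
  have : initial octant (i, j - 1, k - 1) by apply: Rx; rewrite /= /setU /set1 /=; auto.
  by move=> /initial_octant [h1 h2 h3 h4] /initial_octant [g1 g2 g3 g4]; split; lia.
- have : initial octant (i, j, k) by apply: Rx; rewrite /= /setU /set1 /=; auto.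
  have : initial octant (i - 1, j, k - 1) by apply: Rx; rewrite /= /setU /set1 /=; auto.
  by move=> /initial_octant [h1 h2 h3 h4] /initial_octant [g1 g2 g3 g4]; split; lia.
- have : initial octant (i, j, k) by apply: Rx; rewrite /= /setU /set1 /=; auto.
  have : initial octant (i - 1, j - 1, k) by apply: Rx; rewrite /= /setU /set1 /=; auto.
  by move=> /initial_octant [h1 h2 h3 h4] /initial_octant [g1 g2 g3 g4]; split; lia.
Qed.

(* The endpoint on a coordinate axis of the chain of short edges through p. *)
Definition apex (p : Z3) : Z3 :=
  let: (i, j, k) := p in
  if (k <= i) && (k <= j) then (0, 0, k - i - j)
  else if (j <= i) && (j <= k) then (0, j - i - k, 0) else (i - j - k, 0, 0).

(** The cases overlap, unlike the tests in [apex]; on the initial set of the octant they agree where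
    they overlap. *)
Definition apex_spec (i j k a b c : int) : Prop :=
  (k <= i /\ k <= j /\ a = 0 /\ b = 0 /\ c = k - i - j) \/
  (j <= i /\ j <= k /\ a = 0 /\ c = 0 /\ b = j - i - k) \/
  (i <= j /\ i <= k /\ b = 0 /\ c = 0 /\ a = i - j - k).

Lemma apex_specI (i j k a b c : int) :
  (k <= i -> k <= j -> a = 0 /\ b = 0 /\ c = k - i - j) ->
  (j <= i -> j <= k -> a = 0 /\ c = 0 /\ b = j - i - k) ->
  (i <= j -> i <= k -> b = 0 /\ c = 0 /\ a = i - j - k) -> apex_spec i j k a b c.
Proof.
rewrite /apex_spec => h1 h2 h3.
have [[kj ki]|[[ji jk]|[ij ik]]] : (k <= j /\ k <= i) \/ (j <= i /\ j <= k) \/ (i <= j /\ i <= k) by lia.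
- by left; have := h1 ki kj; tauto.
- by right; left; have := h2 ji jk; tauto.
- by right; right; have := h3 ij ik; tauto.
Qed.

Lemma apexE (i j k a b c : int) : initial octant (i, j, k) ->
  (apex (i, j, k) = (a, b, c)) <-> apex_spec i j k a b c.
Proof.
move=> /initial_octant [h1 h2 h3 h4]; rewrite /apex /apex_spec.
by case: ifP => [c1|c1]; [|case: ifP => c2]; rewrite Z3E; lia.
Qed.

(** A uniform description of the boundary sets by their apex. Short edges change the coordinate sum
    by 2, so a chain descending from a higher apex meets exactly one of the values [- N - 1] and
    [- N - 2]; an apex already that low is marked itself. *)
Definition marked (N : int) (r : Z3) : set Z3 :=
  [set p | let: (i, j, k) := p in let: (a, b, c) := r in
    [/\ initial octant (i, j, k), apex_spec i j k a b c
      & i + j + k = - N - 1 \/ i + j + k = - N - 2 \/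
        (i = a /\ j = b /\ k = c /\ i + j + k <= - N - 1)]].

Lemma marked_apex N r p : marked N r p -> apex p = r.
Proof. by case: p r => [[i j] k] [[a b] c] [h1 h2 _]; apply/apexE. Qed.

Ltac set3 := rewrite /setU /set1 /= ?Z3E.
Ltac break := repeat match goal with
  | H : _ \/ _ |- _ => destruct H | H : _ /\ _ |- _ => destruct H end; subst.
Ltac in_marked := split;
  [by apply/initial_octant; split; lia | by apply: apex_specI => ? ?; repeat split; lia | by lia].
Ltac of_marked := case=> /initial_octant [g1 g2 g3 g4]; rewrite /apex_spec => g5 g6; set3;
  break; try (exfalso; lia); lia.

Ltac marked_eq := apply/seteqP; split=> -[[i' j'] k'];
  [set3 => g; break; in_marked | of_marked].

Section Marked.
Variables N p q : int.

Lemma marked_pair_c : 0 > p -> p > q -> p + q = - N - 1 \/ p + q = - N - 2 ->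
  [set (0, p, q); (p, 0, q)] = marked N (0, 0, q - p).
Proof. move=> p0 pq s; marked_eq. Qed.

Lemma marked_pair_b : 0 > p -> p > q -> p + q = - N - 1 \/ p + q = - N - 2 ->
  [set (p, q, 0); (0, q, p)] = marked N (0, q - p, 0).
Proof. move=> p0 pq s; marked_eq. Qed.

Lemma marked_pair_a : 0 > p -> p > q -> p + q = - N - 1 \/ p + q = - N - 2 ->
  [set (q, 0, p); (q, p, 0)] = marked N (q - p, 0, 0).
Proof. move=> p0 pq s; marked_eq. Qed.

Lemma marked_triple : p <= 0 -> 2 * p = - N - 1 \/ 2 * p = - N - 2 ->
  [set (0, p, p); (p, 0, p); (p, p, 0)] = marked N (0, 0, 0).
Proof. move=> p0 s; marked_eq. Qed.

Lemma marked_single_c : q <= 0 -> q <= - N - 1 -> [set (0, 0, q)] = marked N (0, 0, q).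
Proof. move=> q0 s; marked_eq. Qed.

Lemma marked_single_b : q <= 0 -> q <= - N - 1 -> [set (0, q, 0)] = marked N (0, q, 0).
Proof. move=> q0 s; marked_eq. Qed.

Lemma marked_single_a : q <= 0 -> q <= - N - 1 -> [set (q, 0, 0)] = marked N (q, 0, 0).
Proof. move=> q0 s; marked_eq. Qed.
End Marked.

Lemma boundary_set_marked N S u : boundary_set octant N S -> S u -> S = marked N (apex u).
Proof.
move=> [SI h] Su; suff [r E] : exists r, S = marked N r.
  by rewrite E in Su *; rewrite (marked_apex Su).
case: h => [[p [q [p0 pq s [] E]]]|[p s E]|[q s [] E]]; rewrite E.
- by exists (0, 0, q - p); exact: marked_pair_c.
- by exists (0, q - p, 0); exact: marked_pair_b.
- by exists (q - p, 0, 0); exact: marked_pair_a.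
- exists (0, 0, 0); apply: marked_triple => //.
  (* Here [N] may be negative, so the sign of [p] is taken from containment in the initial set. *)
  have : initial octant (0, p, p) by apply: SI; rewrite E; set3; auto.
  by case/initial_octant.
- exists (0, 0, q); apply: marked_single_c => //.
  have : initial octant (0, 0, q) by apply: SI; rewrite E.
  by case/initial_octant.
- exists (0, q, 0); apply: marked_single_b => //.
  have : initial octant (0, q, 0) by apply: SI; rewrite E.
  by case/initial_octant.
- exists (q, 0, 0); apply: marked_single_a => //.
  have : initial octant (q, 0, 0) by apply: SI; rewrite E.
  by case/initial_octant.
Qed.

Lemma apex_axis u : initial octant u -> exists2 d : int, d <= 0 &
  [\/ apex u = (0, 0, d), apex u = (0, d, 0) | apex u = (d, 0, 0)].
Proof.
case: u => [[i j] k] /initial_octant [i0 j0 k0 m0]; rewrite /apex.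
case: ifP => h1; first by exists (k - i - j); [lia|apply: Or31].
case: ifP => h2; first by exists (j - i - k); [lia|apply: Or32].
by exists (i - j - k); [lia|apply: Or33].
Qed.

Lemma boundary_set_exists N u : initial octant u -> boundary_set octant N (marked N (apex u)).
Proof.
move=> Iu; split; first by case: (apex u) => [[a b] c] [[i' j'] k'] [].
have [d d0 Er] := apex_axis Iu.
have [hN|hN] := lerP d (- N - 1).
  apply: Or33; exists d => //; case: Er => ->.
  - by apply: Or31; rewrite (@marked_single_c N).
  - by apply: Or32; rewrite (@marked_single_b N).
  - by apply: Or33; rewrite (@marked_single_a N).
(* Solves [q - p = d] with [p + q] equal to [- N - 1] or [- N - 2]; rounding selects the value of
   the right parity. *)
pose p := ((- N - 1 - d) %/ 2)%Z.
have pE : 2 * p = - N - 1 - d \/ 2 * p = - N - 2 - d by rewrite /p; lia.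
clearbody p; have [d1|dn] := eqVneq d 0.
  subst d; apply: Or32; exists p; first by lia.
  by rewrite (@marked_triple N p); [case: Er => ->|lia|lia].
apply: Or31; exists p, (p + d); split; [lia|lia|lia|].
have dE : d = p + d - p by lia.
case: Er => ->.
- by apply: Or31; rewrite (@marked_pair_c N) -?dE //; lia.
- by apply: Or32; rewrite (@marked_pair_b N) -?dE //; lia.
- by apply: Or33; rewrite (@marked_pair_a N) -?dE //; lia.
Qed.

Lemma marked_self N i j k : initial octant (i, j, k) ->
  i + j + k = - N - 1 \/ i + j + k = - N - 2 -> marked N (apex (i, j, k)) (i, j, k).
Proof.
move=> Iu s; case Er : (apex (i, j, k)) => [[a b] c]; split=> //; last by lia.
exact/apexE.
Qed.

Lemma chosen_set0 x : chosen set0 x = [set x.2; short2 x].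
Proof. by rewrite /chosen /end1 /end2 asboolF. Qed.

Lemma adjacent_short S x : rhombi octant x -> ~ S x ->
  adjacent (graph_of octant S) x.2 (short2 x).
Proof. by move=> Rx nS; exists x => //; rewrite /chosen /end1 /end2 asboolF. Qed.

Lemma adjacent_long S x : rhombi octant x -> S x ->
  adjacent (graph_of octant S) (long1 x) (long2 x).
Proof. by move=> Rx nS; exists x => //; rewrite /chosen /end1 /end2 asboolT. Qed.

Definition descend (d : axis) (t : nat) (p : Z3) : Z3 :=
  iter t (fun q => short2 (d, q)) p.

Lemma descendE d t i j k : descend d t (i, j, k) =
  match d with
  | axis_a => (i, j - t%:Z, k - t%:Z)
  | axis_b => (i - t%:Z, j, k - t%:Z)
  | axis_c => (i - t%:Z, j - t%:Z, k)
  end.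
Proof.
elim: t => [|t IHt]; first by case: d; rewrite /= !subr0.
by rewrite /descend iterS -/(descend d t (i, j, k)) IHt; case: d {IHt} => /=;
  congr (_, _, _); lia.
Qed.

Lemma descend_conn S d p t : rhombi octant (d, p) ->
  (forall s, (s < t)%N -> ~ S (d, descend d s p)) ->
  clos_refl_trans Z3 (adjacent (graph_of octant S)) p (descend d t p).
Proof.
move=> Rp; elim: t => [|t IHt] nS; first exact: rt_refl.
apply: rt_trans (IHt _) _; first by move=> s st; apply: nS; exact: ltnW.
apply: rt_step; apply: (@adjacent_short S (d, descend d t p)); last exact: nS.
move: Rp; case: p {IHt nS} => [[i j] k]; rewrite !rhombi_octant descendE.
by case: d => -[h1 h2 h3]; split; lia.
Qed.

Lemma conn_apex u : initial octant u ->
  clos_refl_trans Z3 (adjacent (graph_of octant set0)) (apex u) u.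
Proof.
case: u => [[i j] k] /initial_octant [i0 j0 k0 m0].
(* The direction is that of a face containing the point; [t] is the absolute value of the coordinate
   in this face that vanishes at the apex. *)
suff [d [t [Rd E]]] : exists d t, octant_rhombus (d, apex (i, j, k)) /\
    (i, j, k) = descend d t (apex (i, j, k)).
  by rewrite {2}E; apply: descend_conn; [exact/rhombi_octant|move=> s _ []].
rewrite /apex; case: ifP => h1; last case: ifP => h2.
- have [iz|jz] : i = 0 \/ j = 0 by lia.
    by exists axis_a, `|j|%N; rewrite descendE Z3E; split; [split|]; lia.
  by exists axis_b, `|i|%N; rewrite descendE Z3E; split; [split|]; lia.
- have [iz|kz] : i = 0 \/ k = 0 by lia.
    by exists axis_a, `|k|%N; rewrite descendE Z3E; split; [split|]; lia.
  by exists axis_c, `|i|%N; rewrite descendE Z3E; split; [split|]; lia.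
- have [jz|kz] : j = 0 \/ k = 0 by lia.
    by exists axis_b, `|k|%N; rewrite descendE Z3E; split; [split|]; lia.
  by exists axis_c, `|j|%N; rewrite descendE Z3E; split; [split|]; lia.
Qed.

(** With [conn_apex], the components of the graph of short edges are exactly the fibres of
    [apex]. *)
Lemma apex_conn u u' :
  clos_refl_trans Z3 (adjacent (graph_of octant set0)) u u' -> apex u = apex u'.
Proof.
elim=> {u u'} [u u' [x /rhombi_octant Rx]|//|u v w _ -> _ -> //].
rewrite chosen_set0 => /linkE.
suff E : apex x.2 = apex (short2 x) by case=> -[-> ->].
by case: x Rx => [[] [[i j] k]] [h1 h2 h3]; rewrite /=;
  case: ifP => c1; [|case: ifP => c2| |case: ifP => c2| |case: ifP => c2];
  (case: ifP => c3; [|case: ifP => c4]); rewrite Z3E; lia.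
Qed.

Lemma boundary_set_nonempty L N S : boundary_set L N S -> exists p, S p.
Proof.
by move=> [_ [[p [q [_ _ _ [] ->]]]|[p _ ->]|[q _ [] ->]]];
  eexists; rewrite /setU /set1 /=; eauto.
Qed.

Lemma grove_conf_octant N : grove_conf octant N set0.
Proof.
split; [by move=> x []|by move=> x _ _ []|apply/connected_withinE].
have mE u p : initial octant u -> marked N (apex u) p ->
    clos_refl_trans Z3 (adjacent (graph_of octant set0)) u p.
  move=> Iu mp; apply: rt_trans (conn_sym (conn_apex Iu)) _.
  by rewrite -(marked_apex mp); apply: conn_apex; case: p (apex u) mp => [[? ?] ?] [[? ?] ?] [].
split.
  move=> u Iu; exists (marked N (apex u)); split.
    by split; [exact: boundary_set_exists|move=> p; exact: mE].
  move=> S [bS Su]; have [p Sp] := boundary_set_nonempty bS.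
  by rewrite (apex_conn (Su p Sp)) (boundary_set_marked bS Sp).
move=> S bS; have [p Sp] := boundary_set_nonempty bS.
have Ip : initial octant p by case: bS => h _; exact: h.
exists p => // q; rewrite (boundary_set_marked bS Sp); exact: mE.
Qed.

Definition height (p : Z3) : int := p.1.1 + p.1.2 + p.2.

(** In a face the apex determines the difference of the two coordinates. This difference is constant
    along short edges, but differs by 2 between the ends of a long edge. *)
Lemma apex_descend_neq x t : octant_rhombus x ->
  apex (descend x.1 t (long1 x)) <> apex (descend x.1 t (long2 x)).
Proof.
by case: x => [[] [[i j] k]] [h1 h2 h3]; rewrite /= !descendE /=;
  case: ifP => c1; [|case: ifP => c2| |case: ifP => c2| |case: ifP => c2];
  (case: ifP => c3; [|case: ifP => c4]); rewrite Z3E; lia.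
Qed.

(* A long edge of least height joins two chains of short edges ending in
   different boundary sets. *)
Lemma grove_conf_octant_uniq N S : grove_conf octant N S -> S = set0.
Proof.
move=> [SR cp /connected_withinE [u1 u2]].
(* The highest corner has the largest sum, so compactness bounds the height of a long rhombus from
   below, and a least one exists. *)
have hN x : S x -> - N <= height x.2.
  move=> Sx; rewrite leNgt; apply/negP => lt; apply: (cp x) => //; first exact: SR.
  by case: x lt {Sx} => [[] [[i j] k]]; rewrite /height /= => lt a b c; rewrite /setU /set1 /= !Z3E; lia.
suff H n x : S x -> height x.2 + N < n%:Z -> False.
  by apply/seteqP; split=> // x Sx; apply: (H `|height x.2 + N|.+1 x Sx); lia.
elim: n x => [|n IHn] x Sx hx; first by have := hN x Sx; lia.
have low y : S y -> height x.2 <= height y.2.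
  by move=> Sy; rewrite leNgt; apply/negP => lt; apply: (IHn y Sy); lia.
have Rx := SR x Sx; have /rhombi_octant Ox := Rx.
(* Both ends of the long edge lie one below the height of [x.2], and each step descends by 2; after
   [t] steps the height is [- N - 1] or [- N - 2]. *)
pose t : nat := `|((height x.2 + N + 1) %/ 2)%Z|%N.
have tE : 2 * t%:Z = height x.2 + N \/ 2 * t%:Z = height x.2 + N + 1.
  by have := hN x Sx; rewrite /t; lia.
have chain q : q = long1 x \/ q = long2 x ->
    [/\ clos_refl_trans Z3 (adjacent (graph_of octant S)) q (descend x.1 t q),
      initial octant (descend x.1 t q) & marked N (apex (descend x.1 t q)) (descend x.1 t q)].
  move=> qx.
  have [Rq hq] : octant_rhombus (x.1, q) /\ height q = height x.2 - 1.
    by case: qx => ->; case: (x) Ox => [[] [[i j] k]] [h1 h2 h3];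
      rewrite /height /=; (split; [split|]); lia.
  have Iq : initial octant (descend x.1 t q).
    case: q Rq {qx hq} => [[i j] k]; rewrite descendE; case: x.1 => -[h1 h2 h3];
      apply/initial_octant; split; lia.
  split=> //.
    apply: descend_conn; first exact/rhombi_octant.
    (* The rhombi along the chain have smaller height than [x.2], so by minimality none of them is
       long. *)
    move=> s st /low; move: hq; case: q {Rq qx Iq} => [[i j] k]; rewrite descendE.
    by case: x.1; rewrite /height /=; lia.
  move: Iq; case: q hq {Rq qx} => [[i j] k]; rewrite descendE {1}/height /= => hq.
  by case: x.1 => Iq; apply: marked_self => //; lia.
have [c1 I1 m1] := chain _ (or_introl erefl); have [c2 I2 m2] := chain _ (or_intror erefl).
have inS q p : initial octant q -> marked N (apex q) q -> marked N (apex q) p ->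
    clos_refl_trans Z3 (adjacent (graph_of octant S)) q p.
  move=> Iq mq mp; have [u _ Su] := u2 _ (boundary_set_exists N Iq).
  by apply: rt_trans (conn_sym (Su _ mq)) (Su _ mp).
have c12 : clos_refl_trans Z3 (adjacent (graph_of octant S))
    (descend x.1 t (long1 x)) (descend x.1 t (long2 x)).
  apply: rt_trans (conn_sym c1) (rt_trans _ _ _ _ _ _ c2).
  by apply: rt_step; exact: adjacent_long.
have [T [_ uT]] := u1 _ I1.
apply: (@apex_descend_neq x t Ox).
have E1 := uT _ (conj (boundary_set_exists N I1) (fun p => inS _ p I1 m1)).
have E2 := uT _ (conj (boundary_set_exists N I2) (fun p mp => rt_trans _ _ _ _ _ c12 (inS _ p I2 m2 mp))).
by have := m2; rewrite -E2 E1 => /marked_apex.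
Qed.

Lemma deg_set2 R S p (x y : rhomb) : x <> y -> incident R S p = [set x; y] -> deg R S p = 2%N.
Proof.
move=> xy E; rewrite /deg E fset_setU1 ?fset_set1; last exact: finite_set1.
by rewrite cardfs2; case: eqP.
Qed.

(** At the origin one short edge starts in each of three faces; on an axis one starts in each of two
    faces; inside a face a chain passes through. *)
Lemma deg_octant p : initial octant p ->
  deg (rhombi octant) set0 p = if p == (0, 0, 0) then 3%N else 2%N.
Proof.
have inc x : incident (rhombi octant) set0 p x <->
    octant_rhombus x /\ (p = x.2 \/ p = short2 x).
  by rewrite /incident /= rhombi_octant chosen_set0.
have two (x y : rhomb) : x <> y -> (forall z, incident (rhombi octant) set0 p z <-> z = x \/ z = y) ->
    deg (rhombi octant) set0 p = 2%N.
  by move=> xy h; apply: (deg_set2 xy); apply/seteqP; split=> z /h.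
case: eqP => [E _|].
  have E3 : incident (rhombi octant) set0 p =
      (axis_a, p) |` [set (axis_b, p); (axis_c, p)].
    apply/seteqP; split=> x.
      move=> /inc; rewrite E; case: x => [[] [[i j] k]] [[h1 h2 h3]]; rewrite /= !Z3E => h.
      - by left; congr (_, (_, _, _)); lia.
      - by right; left; congr (_, (_, _, _)); lia.
      - by right; right; congr (_, (_, _, _)); lia.
    by case=> [->|[->|->]]; apply/inc; split; auto; rewrite E; split.
  rewrite /deg E3 fset_setU1; last exact: finite_set2.
  rewrite fset_setU1 ?fset_set1; last exact: finite_set1.
  by rewrite cardfsU1 cardfs2 !inE; do !case: eqP => //.
case: p inc two => [[i j] k] inc two ne /initial_octant [i0 j0 k0 m0].
have {}ne : i <> 0 \/ j <> 0 \/ k <> 0.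
  by apply: contrapT => h; apply: ne; congr (_, _, _); lia.
have [[zi [nj nk]]|[[zj [ni nk]]|[[zk [ni nj]]|[[zi [zj nk]]|[[zi [zk nj]]|[zj [zk ni]]]]]]] :
   (i = 0 /\ j < 0 /\ k < 0) \/ (j = 0 /\ i < 0 /\ k < 0) \/ (k = 0 /\ i < 0 /\ j < 0) \/
   (i = 0 /\ j = 0 /\ k < 0) \/ (i = 0 /\ k = 0 /\ j < 0) \/ (j = 0 /\ k = 0 /\ i < 0) by lia.
1: apply: (two (axis_a, (i, j, k)) (axis_a, (i, j + 1, k + 1))) => [[]|z]; first by lia.
2: apply: (two (axis_b, (i, j, k)) (axis_b, (i + 1, j, k + 1))) => [[]|z]; first by lia.
3: apply: (two (axis_c, (i, j, k)) (axis_c, (i + 1, j + 1, k))) => [[]|z]; first by lia.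
4: apply: (two (axis_a, (i, j, k)) (axis_b, (i, j, k))) => [//|z].
5: apply: (two (axis_a, (i, j, k)) (axis_c, (i, j, k))) => [//|z].
6: apply: (two (axis_b, (i, j, k)) (axis_c, (i, j, k))) => [//|z].
all: rewrite inc; split;
  [ case: z => [[] [[a b] c]]; rewrite /= !Z3E => -[[h1 h2 h3] h];
    first [ by exfalso; lia
          | by left; congr (_, (_, _, _)); lia
          | by right; congr (_, (_, _, _)); lia
          | by case: h => h; [left|right]; congr (_, (_, _, _)); lia ]
  | by case=> ->; rewrite /= !Z3E; (split; [split; lia|lia]) ].
Qed.

Section OctantSum.
Variables (F : fieldType) (var : axis -> Z3 -> F) (f : Z3 -> F).

Lemma tame_octant : tame (initial octant) (rhombi octant) set0.
Proof.
split; first exact: finite_set0.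
apply: (@sub_finite_set _ _ [set (0, 0, 0)]); last exact: finite_set1.
by move=> p [Ip /=]; rewrite deg_octant //; case: eqP.
Qed.

Lemma weight_octant : weight var f (initial octant) (rhombi octant) set0 = f (0, 0, 0).
Proof.
have E d : edge_weight var d set0 = 1 by apply: fsbig1.
rewrite /weight !E !mul1r /vertex_weight.
have I0 : initial octant (0, 0, 0) by apply/initial_octant; split; auto.
rewrite -(@fsprod_delta F _ (initial octant) (0, 0, 0) (f (0, 0, 0))) //.
apply: eq_fsbigr => p; rewrite inE => Ip; rewrite deg_octant //.
by case: eqP => [->|_]; rewrite ?expr1z ?subrr ?expr0z.
Qed.

Lemma sum_octant N :
  \sum_(S \in [set S | grove_conf octant N S]) weight var f (initial octant) (rhombi octant) S
  = f (0, 0, 0).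
Proof.
have -> : [set S | grove_conf octant N S] = [set set0].
  apply/seteqP; split=> S /=; first exact: grove_conf_octant_uniq.
  by move=> ->; exact: grove_conf_octant.
by rewrite fsbig_set1 weight_octant.
Qed.

End OctantSum.

(** * The induction *)

Section UpperInduction.
Variable L : set Z3.

Lemma cone_refl p : cone p p.
Proof. by case: p => [[i j] k]; split. Qed.

Lemma cone_trans p q : cone p q -> cone q `<=` cone p.
Proof.
move: p q => [[i j] k] [[i' j'] k'] [h1 h2 h3] [[i2 j2] k2] [g1 g2 g3]; split; lia.
Qed.

Lemma cone_anti p q : cone p q -> cone q p -> p = q.
Proof.
by move: p q => [[i j] k] [[i' j'] k'] [h1 h2 h3] [g1 g2 g3]; congr (_, _, _); lia.
Qed.

(** Below [q] there are fewer upper points than below [p], since [p] itself is missing. *)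
Lemma upper_ind (P : Z3 -> Prop) :
  (forall p, upper L p -> finite_set (cone p `&` upper L) ->
     (forall q, cone p q -> q <> p -> upper L q -> P q) -> P p) ->
  forall p, upper L p -> finite_set (cone p `&` upper L) -> P p.
Proof.
move=> step p; move: {2}#|` _| (leqnn #|` fset_set (cone p `&` upper L)|) => n.
elim: n p => [|n IHn] p cn Up fp.
  suff : (0 < #|` fset_set (cone p `&` upper L)|)%N by rewrite ltnNge cn.
  rewrite cardfs_gt0; apply/fset0Pn; exists p.
  by rewrite in_fset_set // inE; split=> //; exact: cone_refl.
apply: step => // q pq nqp Uq.
have sub : cone q `&` upper L `<=` cone p `&` upper L.
  by move=> r [qr Ur]; split=> //; exact: cone_trans qr.
have fq := sub_finite_set sub fp.
apply: IHn => //; rewrite -ltnS; apply: leq_trans cn.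
apply: fproper_ltn_card; apply/andP; split; first by rewrite -fset_set_sub.
apply/negP => /fsubsetP /(_ p); rewrite !in_fset_set // !inE.
move=> /(_ (conj (cone_refl p) Up)) [qp _]; exact: nqp (cone_anti qp pq).
Qed.

Lemma upper_minimal p : upper L p -> finite_set (cone p `&` upper L) ->
  exists w, [/\ cone p w, upper L w & forall q, cone w q -> q <> w -> L q].
Proof.
move: p; apply: (@upper_ind (fun p => exists w,
  [/\ cone p w, upper L w & forall q, cone w q -> q <> w -> L q])) => p Up fp IH.
case: (pselect (exists q, [/\ cone p q, q <> p & upper L q])) => [[q [pq nqp Uq]]|h].
  by have [w [qw Uw m]] := IH q pq nqp Uq; exists w; split=> //; exact: cone_trans qw.
exists p; split=> //; first exact: cone_refl.
by move=> q pq nqp; apply: contrapT => nL; apply: h; exists q.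
Qed.

End UpperInduction.

Section Formula.
Variables (F : fieldType) (var : axis -> Z3 -> F) (f : Z3 -> F).

Definition cube_numerator (p : Z3) : F :=
  let: (i, j, k) := p in
  var axis_b p * var axis_c p * f (i - 1, j, k) * f (i, j - 1, k - 1)
  + var axis_c p * var axis_a p * f (i, j - 1, k) * f (i - 1, j, k - 1)
  + var axis_a p * var axis_b p * f (i, j, k - 1) * f (i - 1, j - 1, k).

Definition cube_recurrence (p : Z3) : Prop :=
  let: (i, j, k) := p in f p * f (i - 1, j - 1, k - 1) = cube_numerator p.

Hypotheses (va : forall i i' j k, var axis_a (i, j, k) = var axis_a (i', j, k))
  (vb : forall i j j' k, var axis_b (i, j, k) = var axis_b (i, j', k))
  (vc : forall i j k k', var axis_c (i, j, k) = var axis_c (i, j, k')).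

(** The function [f] stays fixed while [L] grows. Its hypotheses survive the step because the only
    new initial point was an upper point before. *)
Lemma grove_formula L N : order_ideal L -> L `<=` octant ->
  finite_set (octant `&` upper L) -> cutoff L N ->
  (forall p, octant p -> upper L p -> cube_recurrence p) ->
  (forall p, initial L p \/ (octant p /\ upper L p) -> f p != 0) ->
  [/\ finite_set [set S | grove_conf L N S],
      forall S, grove_conf L N S -> tame (initial L) (rhombi L) S
    & \sum_(S \in [set S | grove_conf L N S]) weight var f (initial L) (rhombi L) S
      = f (0, 0, 0)].
Proof.
move: {2}#|` _| (erefl #|` fset_set (octant `&` upper L)|) => n.
elim: n L => [|n IHn] L cn oL L0 fU cL rec f0.
  have -> : L = octant.
    apply/seteqP; split=> // p Op; apply: contrapT => nL.
    have : p \in fset_set (octant `&` upper L) by rewrite in_fset_set // inE.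
    by move/cardfs0_eq: cn => ->; rewrite inE.
  have E : [set S | grove_conf octant N S] = [set set0].
    apply/seteqP; split=> S /=; first exact: grove_conf_octant_uniq.
    by move=> ->; exact: grove_conf_octant.
  split; [by rewrite E; exact: finite_set1| |exact: sum_octant].
  by move=> S /grove_conf_octant_uniq ->; exact: tame_octant.
have U0 : upper L (0, 0, 0).
  move=> LO; have : (0 < #|` fset_set (octant `&` upper L)|)%N by rewrite cn.
  rewrite cardfs_gt0 => /fset0Pn [p]; rewrite in_fset_set // inE => -[Op].
  by case; apply: oL LO _ Op.
have [w [Ow Uw below]] := upper_minimal U0 fU.
case: w Ow Uw below => [[i j] k] Ow Uw below.
have L'0 : (i, j, k) |` L `<=` octant by move=> p [->|/L0].
have UL' : octant `&` upper ((i, j, k) |` L) = (octant `&` upper L) `\ (i, j, k).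
  apply/seteqP; split=> p.
    by move=> [Op Up]; split; [split=> // Lp; apply: Up; right|move=> E; apply: Up; left].
  by move=> [[Op Up] np]; split=> // -[].
have [|||||||fG tG sG] := IHn ((i, j, k) |` L).
- apply/eqP; rewrite -eqSS -cn UL' fset_setD1 // (cardfsD1 (i, j, k) (fset_set (octant `&` _))).
  by rewrite in_fset_set // mem_set.
- exact: order_ideal' oL below.
- exact: L'0.
- by rewrite UL'; exact: finite_setD.
- exact: (cutoff' oL cL Ow Uw below).
- by move=> p Op Up; apply: rec => // Lp; apply: Up; right.
- move=> p [|[Op Up]]; last by apply: f0; right; split=> // Lp; apply: Up; right.
  rewrite (initialE' oL Uw) => -[->|[Ip _]]; apply: f0; [by right|by left].
have [fG' tG' sG'] := grove_step oL cL Ow Uw below (va _ _ _ _) (vb _ _ _ _) (vc _ _ _ _)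
  (rec _ Ow Uw) (fun p Ip => f0 p (or_introl Ip)) (f0 _ (or_intror (conj Ow Uw))) fG tG.
by split=> //; rewrite sG'.
Qed.

End Formula.

(** * Positivity and nonvanishing of the recurrence values *)

Section Positivity.
Variables (D : idomainType) (e : {rmorphism D -> int}).

(** Only numerator and denominator are evaluated by [e], so no evaluation on the fraction field is
    required. *)
Definition positive (r : {fraction D}) : Prop :=
  exists p q : D, [/\ 0 < e p, 0 < e q & r = tofrac p / tofrac q].

Lemma tofrac_neq0 p : 0 < e p -> tofrac p != 0.
Proof. by move=> p0; rewrite tofrac_eq0; apply: contraTneq p0 => ->; rewrite rmorph0 ltxx. Qed.

Lemma positive_neq0 r : positive r -> r != 0.
Proof. by move=> [p [q [p0 q0 ->]]]; rewrite mulf_neq0 ?invr_eq0 ?tofrac_neq0. Qed.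

Lemma positiveM r s : positive r -> positive s -> positive (r * s).
Proof.
move=> [p [q [p0 q0 ->]]] [p' [q' [p0' q0' ->]]]; exists (p * p'), (q * q').
by rewrite !rmorphM !mulr_gt0 // mulf_div.
Qed.

Lemma positiveV r : positive r -> positive r^-1.
Proof. by move=> [p [q [p0 q0 ->]]]; exists q, p; rewrite invf_div. Qed.

Lemma positiveD r s : positive r -> positive s -> positive (r + s).
Proof.
move=> [p [q [p0 q0 ->]]] [p' [q' [p0' q0' ->]]]; exists (p * q' + p' * q), (q * q').
rewrite rmorphD !rmorphM addr_gt0 ?mulr_gt0 //; split=> //.
by rewrite addf_div ?tofrac_neq0 // tofracD !tofracM.
Qed.

Lemma positive_tofrac p : 0 < e p -> positive (tofrac p).
Proof. by move=> p0; exists p, 1; rewrite rmorph1 tofrac1 divr1. Qed.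

End Positivity.

Definition unit_monomial (m : {cmonom variable}) : int := 1.

Lemma unit_monomial_mmorphism : mmorphism unit_monomial.
Proof. by split=> [m1 m2|]; rewrite /unit_monomial ?mulr1. Qed.

HB.instance Definition _ :=
  isMultiplicative.Build {cmonom variable} int unit_monomial unit_monomial_mmorphism.

(** Evaluation at the point where all variables equal 1. *)
Definition coef_sum : {rmorphism intpoly variable -> int} :=
  mmap (idfun : int -> int) unit_monomial.

Lemma positive_var x : positive coef_sum (Defs.var x).
Proof.
by apply: positive_tofrac; rewrite /= mmapU /= /unit_monomial mulr1.
Qed.

(** The recurrence contains no subtraction, so positivity spreads from the variables to all
    values. *)
Lemma positive_cube_f L p : order_ideal L -> upper L p -> finite_set (cone p `&` upper L) ->
  positive coef_sum (cube_f L p).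
Proof.
move=> oL; move: p; apply: (@upper_ind L (fun p => positive coef_sum (cube_f L p))) => p Up fp IH.
have pI q : initial L q -> positive coef_sum (cube_f L q).
  by move=> Iq; rewrite cube_f_initial //; case: q {Iq} => [[i j] k]; exact: positive_var.
rewrite cube_f_upper //; move: p Up fp IH => [[i j] k] Up fp IH.
have pf a b c : i - 1 <= a <= i -> j - 1 <= b <= j -> k - 1 <= c <= k ->
    (a, b, c) <> (i, j, k) -> positive coef_sum (cube_f L (a, b, c)).
  move=> /andP[a1 a2] /andP[b1 b2] /andP[c1 c2] ne.
  case: (pselect (L (a, b, c))) => [Lq|Uq]; last by apply: IH.
  (* The shift of [(a, b, c)] by (1,1,1) is above [(i, j, k)], hence not in [L]. *)
  apply: pI; split=> // Lq1; apply: Up; apply: (oL _ Lq1); split; lia.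
rewrite /cube_step; apply: positiveM; last first.
  by apply: positiveV; apply: pf; [lia|lia|lia|case; lia].
by apply: positiveD; [apply: positiveD|];
  (apply: positiveM; [apply: positiveM; [apply: positiveM|]|]);
  first [exact: positive_var | by apply: pf; [lia|lia|lia|case; lia]].
Qed.

(** * Grove monomials as weights, and the formula for the recurrence *)

Lemma grove_monomial_weight L S : S `<=` rhombi L ->
  grove_monomial L (graph_of L S) = weight edge_var (cube_f L) (initial L) (rhombi L) S.
Proof.
move=> SR; rewrite /grove_monomial /weight /edge_weight /vertex_weight.
have E d : [set p | edges (graph_of L S) (long_edge d p)] = [set p | S (d, p)].
  apply/seteqP; split=> p; first by move/(@edges_long L S (d, p)) => [].
  by move=> Sp; apply/(@edges_long L S (d, p)); split=> //; apply: SR.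
rewrite !E; congr (_ * _); apply: eq_fsbigr => p; rewrite inE => Ip.
(* On the initial set of [L] itself the values of [cube_f L] are the vertex variables. *)
by rewrite degree_graph_of cube_f_initial.
Qed.

Theorem theorem1 (L : set Z3) (N : int)
    (hL : order_ideal L)
    (hL0 : L `<=` cone (0, 0, 0))
    (hU : finite_set (upper L `&` cone (0, 0, 0)))
    (hN : cutoff L N) :
  cube_f L (0, 0, 0) = \sum_(G \in [set G | grove L N G]) grove_monomial L G.
Proof.
rewrite setIC in hU.
have fin p : octant p -> finite_set (cone p `&` upper L).
  by move=> Op; apply: sub_finite_set hU => q [pq Uq]; split=> //; exact: cone_trans pq.
have pos p : octant p -> upper L p -> positive coef_sum (cube_f L p).
  by move=> Op Up; apply: positive_cube_f => //; exact: fin.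
rewrite sum_groves.
have f0 p : initial L p \/ (octant p /\ upper L p) -> cube_f L p != 0.
  move=> [Ip|[Op Up]]; apply: positive_neq0; last exact: pos.
  by rewrite cube_f_initial //; case: p {Ip} => [[i j] k]; exact: positive_var.
have rec p : octant p -> upper L p -> cube_recurrence edge_var (cube_f L) p.
  move=> Op Up; have := cube_f_upper hL Up (fin _ Op).
  case: p Op Up => [[i j] k] Op Up E; rewrite /cube_recurrence E /cube_step divfK //.
  (* The denominator sits at a point whose shift is the upper point [(i, j, k)], so that point is
     either initial or itself upper. *)
  apply: f0; case: (pselect (L (i - 1, j - 1, k - 1))) => [Lv|Uv]; [left|right].
    by split=> //; rewrite !subrK.
  by split=> //; move: Op => [? ? ?]; split; lia.
have [_ _ <-] := grove_formula (var := edge_var) (fun _ _ _ _ => erefl) (fun _ _ _ _ => erefl)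
  (fun _ _ _ _ => erefl) hL hL0 hU hN rec f0.
by apply: eq_fsbigr => S; rewrite inE => -[SR _ _]; rewrite grove_monomial_weight.
Qed.
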